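(* For every $\alpha>0$ there is a constant $c=c(\alpha)>0$ such that the following holds. Let $d>\ell\ge1$ be integers with $\frac12d-\ell\ge\alpha d$, and let $X$ be a $d$-dimensional $\frac{1}{d^2\ell}$-two-sided link expander. Then for every $r>0$, the $(d,\ell)$-agreement test on $X(d)$ is $\frac r\ell$-approximately $c(1+\frac1r)$-sound. Moreover, for every $\beta>0$ there is $c'=c'(\alpha,\beta)$ such that if in addition $\ell\ge\beta d$, then the test is exactly $c'$-sound: for every ensemble $f$ there is $G$ with $\Pr_{s\in X(d)}[f_s\neq G|_s]\le c'\,\mathrm{rej}(f)$.
   Context: **Weighted simplicial complexes.** A $d$-dimensional simplicial complex $X$ is a downward-closed family of subsets of a finite set. $X(k)$ denotes its faces of size $k+1$ (with $X(-1)=\{\emptyset\}$), and $X(0)$ is identified with the vertices. $X$ is weighted by a probability distribution on $X(d)$, every face being contained in some $d$-face: choose $s_d\in X(d)$ according to this distribution, then a uniformly random chain $s_0\subset\dots\subset s_d$ with $s_i\in X(i)$. The probability of $s\in X(k)$ is $\Pr[s_k=s]$, and conditional choices (''choose $s\in X(k)$ given $s\supseteq t$'') use this measure. The link of $s\in X(k)$ is $X_s=\{u\setminus s:s\subseteq u\in X\}$, with $\Pr_{X_s}[u]=\Pr_X[u\cup s\mid s]$. The underlying graph of $X$ has vertices $X(0)$ and edges $X(1)$, with their measures. **Spectral expansion.** A weighted graph is a $\lambda$-two-sided spectral expander if all eigenvalues of its random-walk operator other than the top eigenvalue $1$ have absolute value at most $\lambda$. $X$ is a $\lambda$-two-sided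 link expander if for every $-1\le k\le d-2$ and every $s\in X(k)$, the underlying graph of $X_s$ is a $\lambda$-two-sided spectral expander. **Agreement tests.** An ensemble over a finite alphabet $\Sigma$ is $f=\{f_s:s\to\Sigma\}_{s\in X(d)}$. - The $(d,\ell)$-agreement test samples $t\in X(\ell)$, then $s_1,s_2\in X(d)$ independently given $t\subseteq s_1,s_2$, and accepts iff $f_{s_1}|_t=f_{s_2}|_t$. - $\mathrm{rej}(f)$ denotes the rejection probability. - The test is $\gamma$-approximately $c$-sound if for every ensemble $f$ there exists $G:X(0)\to\Sigma$ with $\Pr_{s\in X(d)}[\Pr_{v\in s}[f_s(v)\neq G(v)]>\gamma]\le c\cdot\mathrm{rej}(f)$, where $v$ is uniform in $s$. *)

(* Defs.v *)
From HB Require Import structures.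
From mathcomp Require Import all_boot all_order all_algebra.
Set Implicit Arguments. Unset Strict Implicit. Unset Printing Implicit Defensive.
Import Order.TTheory GRing.Theory Num.Theory.
Local Open Scope ring_scope.

(* A simplicial complex on a finite vertex type V is a family X of subsets of V.
   Faces of X(k) are the faces of size k+1; [faces X n] = faces of size n. *)
Definition faces (V : finType) (X : {set {set V}}) (n : nat) : {set {set V}} :=
  [set s in X | #|s| == n].

Definition is_complex (V : finType) (X : {set {set V}}) (d : nat) : Prop :=
  (forall s t : {set V}, s \in X -> t \subset s -> t \in X) /\
  (forall s, s \in X -> exists2 sg, sg \in faces X d.+1 & s \subset sg).

Definition is_weighting (R : numDomainType) (V : finType) (X : {set {set V}})
    (d : nat) (w : {set V} -> R) : Prop :=
  (forall sg, sg \in faces X d.+1 -> 0 < w sg) /\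
  \sum_(sg in faces X d.+1) w sg = 1.

(* Pr[s_k = t] for |t| = k+1: choose s_d ~ w, then a uniform chain; s_k is a
   uniform (k+1)-subset of s_d. *)
Definition prob_face (R : numFieldType) (V : finType) (X : {set {set V}})
    (d : nat) (w : {set V} -> R) (t : {set V}) : R :=
  \sum_(sg in faces X d.+1 | t \subset sg) w sg / ('C(d.+1, #|t|))%:R.

Definition prob_joint (R : numFieldType) (V : finType) (d : nat)
    (w : {set V} -> R) (sg t : {set V}) : R :=
  if t \subset sg then w sg / ('C(d.+1, #|t|))%:R else 0.

Definition prob_cond (R : numFieldType) (V : finType) (X : {set {set V}})
    (d : nat) (w : {set V} -> R) (sg t : {set V}) : R :=
  prob_joint d w sg t / prob_face X d w t.

(* Link of s: measure Pr_{X_s}[u] = Pr_X[u :|: s | s]. *)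
Definition link_prob (R : numFieldType) (V : finType) (X : {set {set V}})
    (d : nat) (w : {set V} -> R) (s u : {set V}) : R :=
  prob_face X d w (u :|: s) /
    (('C(#|u :|: s|, #|s|))%:R * prob_face X d w s).

Definition link_verts (V : finType) (X : {set {set V}}) (s : {set V}) : {set V} :=
  [set v | (v \notin s) && ((v |: s) \in X)].

(* Random-walk operator of a weighted graph with vertex set L and edge
   measure pe (pe e = 0 if e is not an edge):
   M(v,u) = pe {v,u} / sum_{u'} pe {v,u'}. Indexed by 'I_#|L| via enum_val. *)
Definition rw_matrix (R : numFieldType) (V : finType) (L : {set V})
    (pe : {set V} -> R) : 'M[R]_#|L| :=
  \matrix_(i, j)
    (let v := enum_val i in let u := enum_val j in
     if v == u then 0
     else pe [set v; u] / \sum_(u' in L | u' != v) pe [set v; u']).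

(* lam-two-sided spectral expander: the characteristic polynomial is
   ('X - 1) * q (top eigenvalue 1 removed once) and every remaining
   eigenvalue has absolute value at most lam. *)
Definition two_sided_expander (R : rcfType) (n : nat) (M : 'M[R]_n) (lam : R)
  : Prop :=
  exists q : {poly R}, char_poly M = ('X - 1%:P) * q /\
    (forall x, root q x -> `|x| <= lam).

(* lam-two-sided link expander: for all -1 <= k <= d-2 and s in X(k), the
   underlying graph of the link X_s is a lam-two-sided spectral expander. *)
Definition link_expander (R : rcfType) (V : finType) (X : {set {set V}})
    (d : nat) (w : {set V} -> R) (lam : R) : Prop :=
  forall s, s \in X -> (#|s| <= d.-1)%N ->
    two_sided_expander (rw_matrix (link_verts X s) (link_prob X d w s)) lam.

(* Rejection probability of the (d,l)-agreement test on ensemble f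
   (f sg is f_sg, only its values on sg matter). *)
Definition rej (R : numFieldType) (V : finType) (Sigma : finType)
    (X : {set {set V}}) (d l : nat) (w : {set V} -> R)
    (f : {set V} -> V -> Sigma) : R :=
  \sum_(t in faces X l.+1) prob_face X d w t *
    \sum_(s1 in faces X d.+1) \sum_(s2 in faces X d.+1)
      prob_cond X d w s1 t * prob_cond X d w s2 t *
      (~~ [forall v in t, f s1 v == f s2 v])%:R.

Definition approx_sound (R : numFieldType) (V : finType) (Sigma : finType)
    (X : {set {set V}}) (d l : nat) (w : {set V} -> R) (gamma c : R) : Prop :=
  forall f : {set V} -> V -> Sigma, exists G : V -> Sigma,
    \sum_(sg in faces X d.+1 |
            gamma < (#|[set v in sg | f sg v != G v]|)%:R / (d.+1)%:R) w sg
      <= c * rej X d l w f.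

Definition exact_sound (R : numFieldType) (V : finType) (Sigma : finType)
    (X : {set {set V}}) (d l : nat) (w : {set V} -> R) (c : R) : Prop :=
  forall f : {set V} -> V -> Sigma, exists G : V -> Sigma,
    \sum_(sg in faces X d.+1 | [exists v in sg, f sg v != G v]) w sg
      <= c * rej X d l w f.

(* Main.v *)
Require Import Defs.
From HB Require Import structures.
From mathcomp Require Import all_boot all_order all_algebra.
From mathcomp Require Import spectral sesquilinear complex.
From mathcomp Require Import ring lra zify.
Set Implicit Arguments. Unset Strict Implicit. Unset Printing Implicit Defensive.
Import Order.TTheory GRing.Theory Num.Theory.
Local Open Scope ring_scope.

(** Let [eps] be the rejection probability.  For a face [a] of size [l] let
    [h_a] be the most popular restriction to [a] of the local functions; spectral
    expansion of the link of [a] shows that [f_s] restricts to [h_a] except with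
    probability [O(eps)] over pairs [a] in [s].  Among the top faces agreeing with [h_a],
    the value at a further vertex [v] is a single [g_a v] except with probability
    [O(eps / l)]: if two top faces containing [t] differ at exactly one vertex of [t],
    a uniformly random vertex of [t] is that one with probability [1 / (l + 1)].
    For fixed [v], the walk that moves from [a] to a disjoint [b] inside a common top
    face containing [v] has second eigenvalue at most [l ^ 2 lam], whose square is at
    most [1 / l]; hence the values [g_a v] agree with their plurality [G v] up to
    [O(eps / l)] as well.  So, outside top faces of total weight [O(eps)], the expected
    fraction of [s] on which [f_s] differs from [G] is [O(eps / l)], and Markov's
    inequality concludes. *)

(** * Expectations over finite random faces *)

(** A bad event at a face may cost order [eps], but at a further vertex only order [eps / l] is
    affordable. Bad events are therefore split. What depends on [a] and [s] alone is charged once,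
    at cost [eps], to the top face. What is created by revealing [v] is a Chebyshev deviation, whose
    variance carries a factor of at most [(d + 1 - 2 l)^-1 + lam]. The gap [d / 2 - l >= alpha d]
    bounds that factor by [K / l] with [K = alpha^-1 + 1]. A set of faces of measure of order [eps]
    also enters the walk on disjoint faces, but only multiplied by the square of [l ^ 2 lam]. With
    [lam = 1 / (d ^ 2 l)] this is the square of [l / d ^ 2], at most [1 / l]. Exact soundness is the
    same bound at a threshold below [1 / (d + 1)]; when [l >= beta d], the product of [l] and this
    threshold stays bounded below. *)

Section Expectation.
Variables (R : rcfType).

(* [E] is the mean of a probability whose support is contained in [S]. *)
Record expectation (T : Type) (S : T -> bool) (E : (T -> R) -> R) : Prop := {
  exD : forall f g, E (fun x => f x + g x) = E f + E g;
  exZ : forall a f, E (fun x => a * f x) = a * E f;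
  ex_ge0 : forall f, (forall x, S x -> 0 <= f x) -> 0 <= E f;
  ex1 : E (fun=> 1) = 1 }.

Variables (T : Type) (S : T -> bool) (E : (T -> R) -> R).
Hypothesis hE : expectation S E.

Lemma exB f g : E (fun x => f x - g x) = E f - E g.
Proof.
have h0 : E (fun x => g x - g x) = 0.
  apply/eqP; rewrite eq_le; apply/andP; split; last first.
    by apply: (ex_ge0 hE) => x _; rewrite subrr.
  have -> : E (fun x => g x - g x) = - E (fun x => -1 * (g x - g x)).
    by rewrite (exZ hE); ring.
  by rewrite oppr_le0; apply: (ex_ge0 hE) => x _; rewrite subrr mulr0.
have hN : E (fun x => - g x) = - E g.
  by apply/eqP; rewrite -subr_eq0 opprK addrC -(exD hE) h0.
by rewrite (exD hE) hN.
Qed.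

Lemma ex_le f g : (forall x, S x -> f x <= g x) -> E f <= E g.
Proof.
move=> h; rewrite -subr_ge0 -exB; apply: (ex_ge0 hE) => x Sx.
by rewrite subr_ge0 h.
Qed.

(** Positivity alone makes [E] respect equality on its support; values off [S] never matter. *)
Lemma ex_eq f g : (forall x, S x -> f x = g x) -> E f = E g.
Proof.
by move=> h; apply/eqP; rewrite eq_le; apply/andP; split; apply: ex_le => x /h ->.
Qed.

Lemma ex_cst a : E (fun=> a) = a.
Proof.
rewrite -[RHS]mulr1 -(ex1 hE) -(exZ hE).
by apply: ex_eq => x _; rewrite mulr1.
Qed.

Lemma ex_sum (I : Type) (r : seq I) (P : pred I) (f : I -> T -> R) :
  E (fun x => \sum_(i <- r | P i) f i x) = \sum_(i <- r | P i) E (f i).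
Proof.
elim: r => [|i r IH].
  by rewrite big_nil -[RHS]ex_cst; apply: ex_eq => x _; rewrite big_nil.
rewrite big_cons -IH; case: ifP => hP.
  by rewrite -(exD hE); apply: ex_eq => x _; rewrite big_cons hP.
by apply: ex_eq => x _; rewrite big_cons hP.
Qed.

Lemma exZr a f : E (fun x => f x * a) = E f * a.
Proof.
by rewrite mulrC -(exZ hE); apply: ex_eq => x _; rewrite mulrC.
Qed.

Lemma ex_le1 f : (forall x, S x -> f x <= 1) -> E f <= 1.
Proof. by move=> h; rewrite -(ex1 hE); apply: ex_le. Qed.

Lemma ex_variance f : E (fun x => (f x - E f) ^+ 2) = E (fun x => f x ^+ 2) - E f ^+ 2.
Proof.
have -> : E (fun x => (f x - E f) ^+ 2)
   = E (fun x => (f x ^+ 2 + (- 2 * E f) * f x) + E f ^+ 2).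
  by apply: ex_eq => x _; ring.
by rewrite !(exD hE) (exZ hE) ex_cst; ring.
Qed.

(** The mean of [(f - a g)^2] is nonnegative; the free weight [a] takes the place of the
    Cauchy-Schwarz inequality. *)
Lemma ex_cross f g a :
  2 * a * E (fun x => f x * g x) <= E (fun x => f x ^+ 2) + a ^+ 2 * E (fun x => g x ^+ 2).
Proof.
rewrite -!(exZ hE) -(exD hE); apply: ex_le => x _.
rewrite -subr_ge0; apply: le_trans (sqr_ge0 (f x - a * g x)) _.
by rewrite le_eqVlt; apply/orP; left; apply/eqP; ring.
Qed.

Lemma ex_jensen f : E f ^+ 2 <= E (fun x => f x ^+ 2).
Proof.
by rewrite -subr_ge0 -ex_variance; apply: (ex_ge0 hE) => x _; apply: sqr_ge0.
Qed.

Lemma ex_markov (f : T -> R) (a : R) : 0 < a -> (forall x, S x -> 0 <= f x) ->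
  E (fun x => (a < f x)%R%:R) <= a^-1 * E f.
Proof.
move=> a0 f0; rewrite -(exZ hE); apply: ex_le => x Sx.
case: ltP => /= [h|_]; last by apply: mulr_ge0; rewrite ?invr_ge0 ?f0// ltW.
by rewrite mulrC ler_pdivlMr// mul1r ltW.
Qed.

End Expectation.

Lemma expectation_comp (R : rcfType) (T T' : Type) (S : T -> bool) (S' : T -> T' -> bool)
    (E : (T -> R) -> R) (E' : T -> (T' -> R) -> R) :
  expectation S E -> (forall x, S x -> expectation (S' x) (E' x)) ->
  expectation (fun p => S p.1 && S' p.1 p.2)
    (fun F => E (fun x => E' x (fun y => F (x, y)))).
Proof.
move=> hE hE'; split=> [f g|a f|f f0|].
- by rewrite -(exD hE); apply: (ex_eq hE) => x /hE' h; rewrite -(exD h).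
- by rewrite -(exZ hE); apply: (ex_eq hE) => x /hE' h; rewrite -(exZ h).
- apply: (ex_ge0 hE) => x Sx; apply: (ex_ge0 (hE' x Sx)) => y Sy.
  by apply: f0; rewrite /= Sx.
- by rewrite -[RHS](ex1 hE); apply: (ex_eq hE) => x /hE' h; rewrite (ex1 h).
Qed.

(** * Random vertices, sets and top faces in links *)

Section Walks.
Variables (R : rcfType) (V : finType) (X : {set {set V}}) (d : nat).
Variable (w : {set V} -> R).
Hypothesis hX : is_complex X d.
Hypothesis hw : is_weighting X d w.
Implicit Types (c a b s t : {set V}) (u v : V).

(* [mu c / 'C(d.+1, #|c|)] is [prob_face]; dropping the binomial makes the mass of
   [v |: c], summed over [v], proportional to the mass of [c]. *)
Definition mu c : R := \sum_(s in faces X d.+1 | c \subset s) w s.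

(* The means over a random vertex of the link of [c], over a random [k]-set [b] of the
   link of [c] (drawn vertex by vertex), and over a random top face containing [c];
   all of them are [0] when [c] is not a face. *)
Definition vertex_mean c (f : V -> R) : R :=
  (\sum_(v | v \notin c) mu (v |: c) * f v) / ((d.+1 - #|c|)%:R * mu c).

Local Notation E1 := vertex_mean.

Fixpoint set_mean c k (F : {set V} -> R) : R :=
  if k is k'.+1 then E1 c (fun v => set_mean (v |: c) k' (fun b => F (v |: b)))
  else F set0.

Local Notation EE := set_mean.

Lemma EES c k F : EE c k.+1 F = E1 c (fun v => EE (v |: c) k (fun b => F (v |: b))).
Proof. by []. Qed.

Definition top_mean c (F : {set V} -> R) : R :=
  (\sum_(s in faces X d.+1 | c \subset s) w s * F s) / mu c.

Local Notation Es := top_mean.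

Lemma face_sub c v : v |: c \in X -> c \in X.
Proof. by move=> h; apply: (hX.1 _ _ h); apply: subsetUr. Qed.

Lemma topP s : s \in faces X d.+1 -> s \in X /\ #|s| = d.+1.
Proof. by rewrite inE => /andP[-> /eqP ->]. Qed.

Lemma w_gt0 s : s \in faces X d.+1 -> 0 < w s.
Proof. exact: hw.1. Qed.

Lemma mu_gt0 c : c \in X -> 0 < mu c.
Proof.
move=> /hX.2 [s hs cs]; rewrite /mu (bigD1 s) /=; last by rewrite hs cs.
rewrite ltr_wpDr ?w_gt0 //; apply: sumr_ge0 => i /andP[/andP[hi _] _].
by rewrite ltW// w_gt0.
Qed.

Lemma mu_notin c : c \notin X -> mu c = 0.
Proof.
move=> hc; rewrite /mu big1// => s /andP[/topP[sX _] cs].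
by rewrite (hX.1 _ _ sX cs) in hc.
Qed.

Lemma mu_ge0 c : 0 <= mu c.
Proof.
by case: (boolP (c \in X)) => [/mu_gt0/ltW//|/mu_notin->].
Qed.

Lemma mu0 : mu set0 = 1.
Proof.
by rewrite -hw.2 /mu; apply: eq_bigl => s; rewrite sub0set andbT.
Qed.

Lemma set0X : set0 \in X.
Proof.
case: (boolP (set0 \in X)) => // /mu_notin /eqP; by rewrite mu0 oner_eq0.
Qed.

Lemma sum_mu_weighted c (F : V -> {set V} -> R) :
  \sum_(v | v \notin c) \sum_(s in faces X d.+1 | v |: c \subset s) w s * F v s
  = \sum_(s in faces X d.+1 | c \subset s) w s * \sum_(v in s :\: c) F v s.
Proof.
rewrite (exchange_big_dep (fun s => (s \in faces X d.+1) && (c \subset s))) /=; last first.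
  by move=> v s _ /andP[-> /subUsetP[_ ->]].
apply: eq_bigr => s /andP[hs cs]; rewrite mulr_sumr; apply: eq_bigl => v.
by rewrite hs subUset sub1set cs !inE !andbT.
Qed.

(** A top face through [c] is reached from each of its [d.+1 - #|c|] vertices outside [c]; this is
    the normalization in [vertex_mean]. *)
Lemma mu_sum c : \sum_(v | v \notin c) mu (v |: c) = (d.+1 - #|c|)%:R * mu c.
Proof.
have := sum_mu_weighted c (fun _ _ => 1).
rewrite /mu; under eq_bigr do under eq_bigr do rewrite mulr1.
move->; rewrite mulr_sumr; apply: eq_bigr => s /andP[hs cs].
rewrite sumr_const mulrC; congr (_ * _); congr (_%:R).
by rewrite cardsD (setIidPr cs) (topP hs).2.
Qed.

Lemma E1_exp c : c \in X -> (#|c| <= d)%N ->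
  expectation (fun v => (v \notin c) && (v |: c \in X)) (E1 c).
Proof.
move=> cX cd; have n0 : (d.+1 - #|c|)%:R * mu c != 0.
  by rewrite mulf_neq0 ?gt_eqF ?mu_gt0// ltr0n subn_gt0 ltnS.
split=> [f g|a f|f f0|].
- by rewrite /vertex_mean -mulrDl -big_split /=; congr (_ / _); apply: eq_bigr => v _; ring.
- rewrite /vertex_mean mulrA mulr_sumr; congr (_ / _); apply: eq_bigr => v _; ring.
- rewrite /vertex_mean; apply: divr_ge0; last by rewrite mulr_ge0 ?ler0n ?mu_ge0.
  apply: sumr_ge0 => v vc; case: (boolP (v |: c \in X)) => [h|/mu_notin->]; last by rewrite mul0r.
  by rewrite mulr_ge0 ?mu_ge0// f0// vc.
- by rewrite /vertex_mean; under eq_bigr do rewrite mulr1; rewrite mu_sum divff.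
Qed.

Lemma Es_exp c : c \in X ->
  expectation (fun s => (s \in faces X d.+1) && (c \subset s)) (Es c).
Proof.
move=> cX; have n0 : mu c != 0 by rewrite gt_eqF ?mu_gt0.
split=> [f g|a f|f f0|].
- by rewrite /top_mean -mulrDl -big_split /=; congr (_ / _); apply: eq_bigr => v _; ring.
- by rewrite /top_mean mulrA mulr_sumr; congr (_ / _); apply: eq_bigr => v _; ring.
- rewrite /top_mean; apply: divr_ge0; last exact: mu_ge0.
  by apply: sumr_ge0 => s /andP[hs cs]; rewrite mulr_ge0 ?f0 ?hs// ltW// w_gt0.
- by rewrite /top_mean; under eq_bigr do rewrite mulr1; rewrite divff.
Qed.

Definition added c k b := [&& #|b| == k, [disjoint b & c] & b :|: c \in X].

Lemma added_setU1 c k v b : v \notin c -> added (v |: c) k b -> added c k.+1 (v |: b).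
Proof.
move=> vc /and3P[/eqP bk bc bX].
have vb : v \notin b.
  by move: bc; rewrite disjoint_sym disjoints_subset => /subsetP/(_ v); rewrite !inE eqxx => /(_ isT).
rewrite /added cardsU1 vb bk add1n eqxx /= -setUA setUCA bX andbT.
rewrite disjoints_subset subUset sub1set inE vc /=.
apply: subset_trans (_ : _ \subset ~: (v |: c)) _; first by rewrite -disjoints_subset.
by rewrite setCS subsetUr.
Qed.

Lemma EE_exp c k : c \in X -> (#|c| + k <= d.+1)%N -> expectation (added c k) (EE c k).
Proof.
elim: k c => [|k IH] c cX ck.
  split=> //= f; apply; rewrite /added cards0 eqxx set0U cX andbT /=.
  by rewrite disjoints_subset sub0set.
have cd : (#|c| <= d)%N by lia.
have hE := E1_exp cX cd.
have hEE v : (v \notin c) && (v |: c \in X) -> expectation (added (v |: c) k) (EE (v |: c) k).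
  by move=> /andP[vc vX]; apply: IH => //; rewrite cardsU1 vc; lia.
split=> [f g|a f|f f0|] /=.
- by rewrite -(exD hE); apply: (ex_eq hE) => x /hEE h; rewrite -(exD h).
- by rewrite -(exZ hE); apply: (ex_eq hE) => x /hEE h; rewrite -(exZ h).
- apply: (ex_ge0 hE) => x Sx; apply: (ex_ge0 (hEE x Sx)) => y Sy.
  by apply: f0; apply: added_setU1 Sy; case/andP: Sx.
- by rewrite -[RHS](ex1 hE); apply: (ex_eq hE) => x /hEE h; rewrite (ex1 h).
Qed.

(** The mass of the intermediate face [v |: c] cancels, so ordered pairs of vertices get a weight
    symmetric in [u] and [v]. This exchangeability is behind all the swap lemmas. *)
Lemma E1E1 c (f : V -> V -> R) : c \in X ->
  E1 c (fun v => E1 (v |: c) (f v)) =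
  (\sum_(v | v \notin c) \sum_(u | u \notin v |: c) mu (u |: (v |: c)) * f v u)
   / ((d.+1 - #|c|)%:R * (d.+1 - #|c|).-1%:R * mu c).
Proof.
move=> cX; rewrite {1}/vertex_mean !mulr_suml; apply: eq_bigr => v vc.
case: (boolP (v |: c \in X)) => hv; last first.
  rewrite mu_notin// !mul0r big1 ?mul0r// => u _.
  by rewrite mu_notin ?mul0r//; apply: contra hv; apply: face_sub.
have := mu_gt0 hv => m0.
rewrite /vertex_mean cardsU1 vc add1n subnS.
rewrite [in RHS]invfM [in RHS]invfM [in LHS]invfM [in LHS]invfM.
set S := \sum_(i | _) _; set x := (_ - _)%:R; set y := (_.-1)%:R.
have -> : mu (v |: c) * (S * (y^-1 * (mu (v |: c))^-1)) * (x^-1 * (mu c)^-1)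
  = S * (x^-1 * y^-1 * (mu c)^-1) * (mu (v |: c) / mu (v |: c)) by ring.
by rewrite divff ?gt_eqF// mulr1.
Qed.

Lemma E1_swap c (f : V -> V -> R) : c \in X ->
  E1 c (fun v => E1 (v |: c) (f v)) = E1 c (fun u => E1 (u |: c) (fun v => f v u)).
Proof.
move=> cX; rewrite !E1E1//; congr (_ / _).
rewrite (exchange_big_dep (fun u => u \notin c)) /=; last first.
  by move=> v u _; rewrite !inE negb_or => /andP[].
apply: eq_bigr => u uc; apply: eq_big => v.
  by rewrite !inE !negb_or uc andbT eq_sym andbC.
by rewrite setUCA.
Qed.

Lemma cardU1_lt c k v : v \notin c -> (#|c| + k.+1 <= d.+1)%N -> (#|v |: c| + k <= d.+1)%N.
Proof. by move=> vc; rewrite cardsU1 vc; lia. Qed.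

Lemma EE_swap1 c k (F : V -> {set V} -> R) : c \in X -> (#|c| + k.+1 <= d.+1)%N ->
  E1 c (fun v => EE (v |: c) k (F v)) = EE c k (fun a => E1 (a :|: c) (fun v => F v a)).
Proof.
elim: k c F => [|k IH] c F cX ck /=; first by rewrite set0U.
rewrite E1_swap//; apply: (ex_eq (E1_exp cX _)); first by lia.
move=> u /andP[uc uX]; have ck' := cardU1_lt uc ck.
transitivity (E1 (u |: c) (fun v => EE (v |: (u |: c)) k (fun a => F v (u |: a)))).
  apply: (ex_eq (E1_exp uX _)); first by lia.
  by move=> v _; rewrite setUCA.
rewrite IH//; apply: (ex_eq (EE_exp uX _)); first by lia.
by move=> a _; rewrite setUCA setUA.
Qed.

Lemma EE_recr c k (F : {set V} -> R) : c \in X -> (#|c| + k.+1 <= d.+1)%N ->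
  EE c k.+1 F = EE c k (fun a => E1 (a :|: c) (fun v => F (v |: a))).
Proof. by move=> cX ck; rewrite -(EE_swap1 (fun v a => F (v |: a))). Qed.

Lemma EE_swap c i j (F : {set V} -> {set V} -> R) : c \in X -> (#|c| + i + j <= d.+1)%N ->
  EE c i (fun a => EE (a :|: c) j (F a)) = EE c j (fun b => EE (b :|: c) i (fun a => F a b)).
Proof.
elim: j c F => [|j IH] c F cX cij /=; first by rewrite set0U.
rewrite -(EE_swap1 (fun v a => EE (v |: (a :|: c)) j (fun b => F a (v |: b))))//; last by lia.
apply: (ex_eq (E1_exp cX _)); first by lia.
move=> v /andP[vc vX]; have hc := cardsU1 v c; rewrite vc in hc.
transitivity (EE (v |: c) i (fun a => EE (a :|: (v |: c)) j (fun b => F a (v |: b)))).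
  apply: (ex_eq (EE_exp vX _)); first by lia.
  by move=> a _; rewrite setUCA.
rewrite IH//; last by lia.
apply: (ex_eq (EE_exp vX _)); first by lia.
by move=> b _; rewrite setUCA setUA.
Qed.

(** Both sides weight the pair of [v] and [s] proportionally to [w s]: a link vertex followed by a
    top face through it is a top face followed by a uniform vertex outside [c]. *)
Lemma E1_Es c (F : V -> {set V} -> R) : c \in X ->
  E1 c (fun v => Es (v |: c) (F v)) =
  Es c (fun s => (d.+1 - #|c|)%:R^-1 * \sum_(v in s :\: c) F v s).
Proof.
move=> cX; rewrite /vertex_mean /top_mean.
under eq_bigr => v vc.
  have -> : forall x, mu (v |: c) * ((\sum_(s in faces X d.+1 | v |: c \subset s) w s * F v s)
      / x) = (\sum_(s in faces X d.+1 | v |: c \subset s) w s * F v s) * (mu (v |: c) / x).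
    by move=> x; ring.
  over.
transitivity ((\sum_(v | v \notin c) \sum_(s in faces X d.+1 | v |: c \subset s) w s * F v s)
   / ((d.+1 - #|c|)%:R * mu c)).
  congr (_ / _); apply: eq_bigr => v vc.
  case: (boolP (v |: c \in X)) => hv; first by rewrite divff ?mulr1// gt_eqF ?mu_gt0.
  rewrite [LHS](_ : _ = 0) ?[RHS]big1//.
    move=> s /andP[/topP[sX _] cs]; by rewrite (hX.1 _ _ sX cs) in hv.
  by rewrite mu_notin// mul0r mulr0.
rewrite sum_mu_weighted invfM mulrA; congr (_ / _).
rewrite mulr_suml; apply: eq_bigr => s _; ring.
Qed.

Lemma Es_tower1 c F : c \in X -> (#|c| <= d)%N ->
  Es c F = E1 c (fun v => Es (v |: c) F).
Proof.
move=> cX cd; rewrite E1_Es//; apply: (ex_eq (Es_exp cX)) => s /andP[/topP[_ sd] cs].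
rewrite sumr_const cardsD (setIidPr cs) sd -[X in _ = _ * X]mulr_natl mulrA mulVf ?mul1r//.
by rewrite pnatr_eq0; lia.
Qed.

Lemma Es_tower c k F : c \in X -> (#|c| + k <= d.+1)%N ->
  Es c F = EE c k (fun b => Es (b :|: c) F).
Proof.
elim: k c => [|k IH] c cX ck /=; first by rewrite set0U.
rewrite Es_tower1//; last by lia.
apply: (ex_eq (E1_exp cX _)); first by lia.
move=> v /andP[vc vX]; rewrite IH//; last exact: cardU1_lt ck.
apply: (ex_eq (EE_exp vX _)); first exact: cardU1_lt ck.
by move=> b _; rewrite setUCA setUA.
Qed.

(* Singling out a uniformly random element of a random [k.+1]-set is the same as
   drawing a [k]-set and then one more vertex. *)
Lemma EE_sum_in c k (f : {set V} -> V -> R) : c \in X -> (#|c| + k.+1 <= d.+1)%N ->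
  EE c k.+1 (fun t => \sum_(v in t) f (t :\ v) v) =
  k.+1%:R * EE c k (fun a => E1 (a :|: c) (f a)).
Proof.
elim: k c f => [|k IH] c f cX ck.
  rewrite mul1r /= set0U; apply: (ex_eq (E1_exp cX _)); first by lia.
  by move=> v _; rewrite setU0 big_set1 setDv.
rewrite [LHS]EES -(addn1 k.+1) natrD mulrDl mul1r addrC -[X in _ = X + _](EE_swap1 (fun v a => f a v))//.
rewrite EES -(exZ (E1_exp cX _)); last by lia.
rewrite -(exD (E1_exp cX _)); last by lia.
apply: (ex_eq (E1_exp cX _)); first by lia.
move=> u /andP[uc uX]; have ck' := cardU1_lt uc ck.
have hk := EE_exp uX ck'.
transitivity (EE (u |: c) k.+1 (fun b => f b u + \sum_(v in b) f (u |: (b :\ v)) v)).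
  apply: (ex_eq hk) => b /and3P[_ bc bX].
  have ub : u \notin b.
    by move: bc; rewrite disjoint_sym disjoints_subset => /subsetP/(_ u); rewrite !inE eqxx => /(_ isT).
  rewrite big_setU1//= setU1K//; congr (_ + _); apply: eq_bigr => v vb.
  congr (f _ v); apply/setP => x; rewrite !inE.
  case: (eqVneq x u) => //= ->; rewrite andbT; apply: contraNN ub => /eqP ->//.
rewrite (exD hk) (IH _ (fun a v => f (u |: a) v))//; congr (_ + _ * _).
apply: (ex_eq (EE_exp uX _)); first by lia.
by move=> a _; rewrite setUCA setUA.
Qed.

End Walks.

Lemma char_poly_similar (F : fieldType) (n : nat) (A B P : 'M[F]_n) :
  P \in unitmx -> A *m P = P *m B -> char_poly A = char_poly B.
Proof.
move=> hP hAB.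
have hdet : \det (map_mx polyC P) != 0.
  by rewrite det_map_mx polyC_eq0 -unitfE -unitmxE.
apply: (mulIf hdet); rewrite /char_poly -det_mulmx [RHS]mulrC -det_mulmx.
congr (\det _); rewrite /char_poly_mx mulmxBl mulmxBr -!map_mxM hAB.
by rewrite -scalar_mxC.
Qed.

(** * From the characteristic polynomial to quadratic forms *)

Section SpectralGap.
Local Notation conjC := Num.conj.
Local Open Scope sesquilinear_scope.

(* In an eigenbasis over [R[i]] the factor ['X - 1] accounts for exactly one vector,
   since [lam < 1]; that vector spans the line of [v0]. *)
Lemma symmetric_spectral_gap (R : rcfType) (n : nat) (S : 'M[R]_n) (v0 : 'rV[R]_n)
    (q : {poly R}) (lam : R) :
  S^T = S -> v0 *m S = v0 -> v0 != 0 ->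
  char_poly S = ('X - 1%:P) * q -> (forall x, root q x -> `|x| <= lam) -> lam < 1 ->
  forall x : 'rV[R]_n, x *m v0^T = 0 ->
    `|(x *m S *m x^T) 0 0| <= lam * (x *m x^T) 0 0.
Proof.
move=> Ssym Sv v0n0 Sq qlam lam1 x xv0.
pose C := R[i]%C; pose toC := real_complex R : {rmorphism R -> C}.
pose Sc : 'M[C]_n := map_mx toC S.
have cjR (a : R) : conjC (toC a) = toC a.
  by apply/CrealP/complex_realP; exists a.
have Sherm : Sc \is hermsymmx.
  apply: realsym_hermsym.
    by apply/is_hermitianmxP; rewrite expr0 scale1r; apply/matrixP => i j; rewrite !mxE -{1}Ssym mxE.
  by apply/mxOverP => i j; rewrite mxE; apply/complex_realP; exists (S i j).
set P := spectralmx Sc; set D := spectral_diag Sc.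
have PU : P \is unitarymx by apply: spectral_unitarymx.
have Punit : P \in unitmx by apply: unitarymx_unit.
have SE : Sc = invmx P *m diag_mx D *m P.
  exact/orthomx_spectralP/hermitian_normalmx.
have cS : char_poly Sc = \prod_i ('X - (D 0 i)%:P).
  rewrite (@char_poly_similar _ _ Sc (diag_mx D) (invmx P)) ?unitmx_inv//.
    rewrite char_poly_trig ?diag_mx_is_trig//.
    by apply: eq_bigr => i _; rewrite mxE eqxx mulr1n.
  by rewrite SE mulmxK.
have Dreal i : exists r : R, D 0 i = toC r.
  apply/complex_realP; exact: (mxOverP (hermitian_spectral_diag_real Sherm)).
have cSq : char_poly Sc = ('X - 1%:P) * map_poly toC q.
  by rewrite -map_char_poly Sq rmorphM /= rmorphB /= map_polyX map_polyC /= rmorph1.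
have [i0 Di0] : exists i, D 0 i = 1.
  have : root (char_poly Sc) 1 by rewrite cSq rootM root_XsubC eqxx.
  rewrite cS rootE horner_prod => /prodf_eq0 [i _].
  by rewrite hornerXsubC subr_eq0 eq_sym => /eqP h; exists i.
have qE : map_poly toC q = \prod_(i | i != i0) ('X - (D 0 i)%:P).
  have h1 : ('X - 1%:P : {poly C}) != 0 by rewrite polyXsubC_eq0.
  by apply: (mulfI h1); rewrite -cSq cS (bigD1 i0)//= Di0.
have Dlam i : i != i0 -> exists2 r : R, D 0 i = toC r & `|r| <= lam.
  move=> hi; have [r hr] := Dreal i; exists r => //; apply: qlam.
  rewrite -(fmorph_root toC) qE rootE horner_prod; apply/prodf_eq0.
  by exists i => //; rewrite hornerXsubC -hr subrr.
pose y := map_mx toC x *m invmx P; pose z := map_mx toC v0 *m invmx P.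
have invP : invmx P = P ^t conjC by apply: invmx_unitary.
have tcj m (A : 'M[R]_(m, n)) : (map_mx toC A ^t conjC) = map_mx toC (A^T).
  by apply/matrixP => i j; rewrite !mxE.
have dotE (a b : 'rV[R]_n) : toC ((a *m b^T) 0 0)
    = \sum_i (map_mx toC a *m invmx P) 0 i * conjC ((map_mx toC b *m invmx P) 0 i).
  transitivity ((map_mx toC a *m invmx P *m (map_mx toC b *m invmx P)^t conjC) 0 0).
    rewrite trmx_mul map_mxM /= tcj invP trmxCK mulmxA mulmxKtV ?unitarymx_unit//.
    by rewrite -map_mxM [RHS]mxE.
  by rewrite mxE; apply: eq_bigr => i _; rewrite !mxE.
have zeig i : i != i0 -> z 0 i = 0.
  move=> hi; have : z *m diag_mx D = z.
    have : map_mx toC v0 *m Sc = map_mx toC v0 by rewrite -map_mxM Sv.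
    by rewrite SE /z => h; rewrite -[in RHS]h !mulmxA mulmxK.
  move=> /matrixP /(_ 0 i); rewrite mul_mx_diag mxE => /eqP.
  rewrite -subr_eq0 -{2}[z 0 i]mulr1 -mulrBr mulf_eq0 => /orP[/eqP//|].
  have [r -> hr] := Dlam i hi.
  rewrite subr_eq0 -(rmorph1 toC) => /eqP/complexI r1.
  by move: hr; rewrite r1 normr1 leNgt lam1.
have zi0 : z 0 i0 != 0.
  apply: contra v0n0 => /eqP hz.
  have z0 : z = 0.
    by apply/rowP => i; rewrite [RHS]mxE; case: (eqVneq i i0) => [->|/zeig].
  have : map_mx toC v0 = 0 by rewrite -[LHS](mulmxKV Punit) -/z z0 mul0mx.
  by move=> /eqP; rewrite map_mx_eq0.
have yi0 : y 0 i0 = 0.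
  have := dotE x v0; rewrite xv0 mxE rmorph0 (bigD1 i0)//= -/y -/z big1 ?addr0.
    move=> /esym/eqP; rewrite mulf_eq0 conjC_eq0 (negbTE zi0) orbF => /eqP //.
  by move=> i hi; rewrite zeig// conjC0 mulr0.
have xx := dotE x x; rewrite -/y in xx.
have xSx : toC ((x *m S *m x^T) 0 0) = \sum_i (D 0 i) * (y 0 i * conjC (y 0 i)).
  rewrite dotE map_mxM -/Sc SE -/y; apply: eq_bigr => i _.
  by rewrite !mulmxA mulmxK// mul_mx_diag [X in X * _]mxE -/y -mulrA mulrCA mulrA; ring.
have : `|toC ((x *m S *m x^T) 0 0)| <= toC (lam * (x *m x^T) 0 0).
  rewrite rmorphM /= xx xSx mulr_sumr; apply: le_trans (ler_norm_sum _ _ _) _.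
  apply: ler_sum => i _; rewrite normrM.
  rewrite [`|_ * conjC _|]ger0_norm ?mul_conjC_ge0//.
  case: (eqVneq i i0) => [->|/Dlam [r -> hr]].
    by rewrite yi0 !mul0r !mulr0.
  apply: ler_wpM2r; first exact: mul_conjC_ge0.
  by rewrite normc_def /= expr0n /= addr0 sqrtr_sqr lecR.
by rewrite normc_def /= expr0n /= addr0 sqrtr_sqr lecR.
Qed.

End SpectralGap.

(** * The random walk on the graph of a link *)

Section LinkGraph.
Variables (R : rcfType) (V : finType) (X : {set {set V}}) (d : nat).
Variable (w : {set V} -> R).
Hypothesis hX : is_complex X d.
Hypothesis hw : is_weighting X d w.
Implicit Types (c : {set V}) (u v : V).
Local Notation mu := (mu X d w).
Local Notation E1 := (vertex_mean X d w).

Lemma prob_faceE c : prob_face X d w c = mu c / 'C(d.+1, #|c|)%:R.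
Proof. by rewrite /prob_face /mu -mulr_suml. Qed.

Lemma sum_link c (h : V -> R) :
  \sum_(v | v \notin c) mu (v |: c) * h v = \sum_(v in link_verts X c) mu (v |: c) * h v.
Proof.
rewrite (bigID (fun v => v |: c \in X)) /= [X in _ + X]big1 ?addr0; last first.
  by move=> v /andP[_ hv]; rewrite mu_notin ?mul0r.
by apply: eq_bigl => v; rewrite inE.
Qed.

(** The binomial factor is common to all edges of the link, so it disappears once [rw_matrix]
    normalizes its rows. *)
Lemma link_probE c v u : c \in X -> v \in link_verts X c -> u \in link_verts X c -> v != u ->
  link_prob X d w c [set v; u] =
  mu (u |: (v |: c)) * ('C(d.+1, #|c|)%:R / ('C(d.+1, #|c|.+2)%:R * 'C(#|c|.+2, #|c|)%:R * mu c)).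
Proof.
move=> cX; rewrite !inE => /andP[vc _] /andP[uc _] vu.
have e : [set v; u] :|: c = u |: (v |: c) by rewrite setUCA setUA.
rewrite /link_prob e !prob_faceE.
have -> : #|u |: (v |: c)| = #|c|.+2.
  by rewrite !cardsU1 vc !inE negb_or uc eq_sym vu.
set a := mu (u |: _); set x := mu c; rewrite !invfM !invrK; ring.
Qed.

Lemma rw_matrixE c (i j : 'I_#|link_verts X c|) : c \in X -> (#|c| < d)%N ->
  let v := enum_val i in let u := enum_val j in
  rw_matrix (link_verts X c) (link_prob X d w c) i j =
  (v != u)%:R * mu (u |: (v |: c)) / ((d - #|c|)%:R * mu (v |: c)).
Proof.
move=> cX cd v u; rewrite /rw_matrix mxE -/v -/u.
have vL : v \in link_verts X c by apply: enum_valP.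
have uL : u \in link_verts X c by apply: enum_valP.
have [vc vX] : v \notin c /\ v |: c \in X by move: vL; rewrite inE => /andP.
case: (eqVneq v u) => [_|vu]; first by rewrite !mul0r.
rewrite mul1r link_probE//; set K := (_ / _ : R).
have -> : \sum_(u' in link_verts X c | u' != v) link_prob X d w c [set v; u']
   = ((d - #|c|)%:R * mu (v |: c)) * K.
  transitivity (\sum_(u' | u' \notin v |: c) mu (u' |: (v |: c)) * K).
    rewrite [RHS](bigID (fun u => u |: c \in X)) /= [X in _ = _ + X]big1 ?addr0; last first.
      move=> x /andP[_ hx]; rewrite mu_notin ?mul0r//.
      apply: contra hx; rewrite setUCA => hx; exact: (face_sub hX hx).
    apply: eq_big => x; first by rewrite !inE negb_or andbC andbA.
    by move=> /andP[xL xv]; rewrite link_probE// eq_sym.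
  by rewrite -mulr_suml mu_sum// cardsU1 vc.
have K0 : K != 0.
  rewrite /K mulf_neq0 ?invr_neq0 ?mulf_neq0//; rewrite ?gt_eqF ?mu_gt0//;
    by rewrite ltr0n bin_gt0; lia.
by rewrite invfM mulrACA divff// mulr1.
Qed.

(** Expansion in the only form used later: the left side is the covariance of [f] at the two ends of
    a random edge of the link. After centring, the values of [f] weighted by square roots of degrees
    are orthogonal to the top eigenvector [v0]. *)
Lemma link_quadratic c lam (f : V -> R) : c \in X -> (#|c| < d)%N -> 0 <= lam -> lam < 1 ->
  two_sided_expander (rw_matrix (link_verts X c) (link_prob X d w c)) lam ->
  `|E1 c (fun v => f v * E1 (v |: c) f) - E1 c f ^+ 2| <= lam * E1 c (fun v => f v ^+ 2).
Proof.
move=> cX cd lam0 lam1 [q [hq qlam]].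
set L := link_verts X c in hq *.
pose deg v := mu (v |: c).
pose m v u : R := (v != u)%:R * mu (u |: (v |: c)).
have degP v : v \in L -> 0 < deg v by rewrite inE => /andP[_]; apply: mu_gt0.
have msym v u : m v u = m u v by rewrite /m eq_sym setUCA.
pose N : R := (d - #|c|)%:R.
have N0 : 0 < N by rewrite ltr0n subn_gt0.
have msum v (h : V -> R) : v \in L ->
    \sum_(u | u \notin v |: c) mu (u |: (v |: c)) * h u = \sum_(u in L) m v u * h u.
  rewrite inE => /andP[vc vX]; rewrite [RHS](bigID (fun u => u == v)) /= [X in X + _]big1 ?add0r; last first.
    by move=> u /andP[_ /eqP ->]; rewrite /m eqxx !mul0r.
  rewrite (bigID (fun u => u |: c \in X)) /= [X in _ + X]big1 ?addr0; last first.
    move=> x /andP[_ hx]; rewrite mu_notin ?mul0r//.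
    apply: contra hx; rewrite setUCA => hx; exact: (face_sub hX hx).
  apply: eq_big => x; first by rewrite !inE negb_or [RHS]andbC andbA.
  by move=> /andP[]; rewrite !inE negb_or /m eq_sym => /andP[-> _] _; rewrite mul1r.
have degE v : v \in L -> \sum_(u in L) m v u = N * deg v.
  move=> vL; transitivity (\sum_(u in L) m v u * 1).
    by apply: eq_bigr => u _; rewrite mulr1.
  rewrite -msum//; under eq_bigr do rewrite mulr1.
  by rewrite mu_sum// cardsU1; move: vL; rewrite inE => /andP[-> _].
pose sq v := Num.sqrt (deg v).
have sqP v : v \in L -> 0 < sq v by move=> /degP; rewrite sqrtr_gt0.
have sq2 v : v \in L -> sq v * sq v = deg v.
  by move=> /degP h; rewrite -expr2 sqr_sqrtr// ltW.
pose ev (i : 'I_#|L|) : V := enum_val i.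
have evP i : ev i \in L by apply: enum_valP.
(* Conjugating the walk by the square root of the vertex measure makes it symmetric. *)
pose S : 'M[R]_#|L| := \matrix_(i, j) (m (ev i) (ev j) / (N * sq (ev i) * sq (ev j))).
pose P : 'M[R]_#|L| := diag_mx (\row_i (sq (ev i))^-1).
pose v0 : 'rV[R]_#|L| := \row_i sq (ev i).
have Ssym : S^T = S.
  by apply/matrixP => i j; rewrite !mxE msym; congr (_ / _); ring.
have cS : char_poly S = ('X - 1%:P) * q.
  rewrite -hq; apply/esym/(@char_poly_similar _ _ _ _ P).
    rewrite unitmxE det_diag unitfE; apply/prodf_neq0 => i _.
    by rewrite mxE invr_eq0 gt_eqF ?sqP.
  apply/matrixP => i j; rewrite mul_mx_diag mul_diag_mx mxE [in RHS]mxE rw_matrixE// !mxE.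
  rewrite -/N -/(deg _) -/(m _ _) -/(ev i) -/(ev j) -sq2// !invfM; ring.
have Sv : v0 *m S = v0.
  apply/rowP => j; rewrite mxE [RHS]mxE.
  transitivity (\sum_i m (ev j) (ev i) / (N * sq (ev j))).
    apply: eq_bigr => i _; rewrite !mxE msym !invfM.
    have : sq (ev i) / sq (ev i) = 1 by rewrite divff ?gt_eqF ?sqP.
    move: (sq (ev i)) => z hz; rewrite -[RHS]mulr1 -hz; ring.
  rewrite -mulr_suml -(big_enum_val (fun u => m (ev j) u)) degE// -sq2//.
  by rewrite invfM mulrACA divff ?gt_eqF// mul1r mulfK// gt_eqF ?sqP.
have n0 : exists i : 'I_#|L|, true.
  have hE := E1_exp hX hw cX (ltnW cd).
  case: (posnP #|L|) => [L0|h]; last by exists (Ordinal h).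
  have := ex1 hE; rewrite /vertex_mean sum_link big1 ?mul0r; last first.
    by move=> v; rewrite -/L (cards0_eq L0) inE.
  by move=> /esym/eqP; rewrite oner_eq0.
have v00 : v0 != 0.
  have [i _] := n0; apply/eqP => /rowP/(_ i); rewrite !mxE => /eqP.
  by rewrite gt_eqF ?sqP.
have gap := symmetric_spectral_gap Ssym Sv v00 cS qlam lam1.
have hE := E1_exp hX hw cX (ltnW cd).
pose t := E1 c f; pose g v := f v - t.
have g0 : E1 c g = 0 by rewrite (exB hE) (ex_cst hE) subrr.
pose M : R := (d.+1 - #|c|)%:R * mu c.
have M0 : 0 < M by rewrite mulr_gt0 ?mu_gt0// ltr0n; lia.
have E1L h : E1 c h = (\sum_(v in L) deg v * h v) / M by rewrite /vertex_mean sum_link.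
have gg : `|E1 c (fun v => g v * E1 (v |: c) g)| <= lam * E1 c (fun v => g v ^+ 2).
  pose x : 'rV[R]_#|L| := \row_i (g (ev i) * sq (ev i)).
  have xv0 : x *m v0^T = 0.
    apply/rowP => j; rewrite [j]ord1 !mxE.
    move/eqP: g0; rewrite E1L mulf_eq0 invr_eq0 (gt_eqF M0) orbF => /eqP gL; rewrite -[RHS]gL.
    rewrite [RHS]big_enum_val; apply: eq_bigr => i _; rewrite !mxE -/(ev i) -sq2//; ring.
  have := gap _ xv0.
  have -> : (x *m x^T) 0 0 = M * E1 c (fun v => g v ^+ 2).
    rewrite E1L mulrCA divff ?gt_eqF// mulr1 mxE [RHS]big_enum_val; apply: eq_bigr => i _.
    rewrite !mxE -/(ev i) -sq2//; ring.
  have -> : (x *m S *m x^T) 0 0 = M * E1 c (fun v => g v * E1 (v |: c) g).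
    transitivity (\sum_(v in L) \sum_(u in L) (g v * (m v u * g u)) / N).
      rewrite mxE (big_enum_val (fun v => \sum_(u in L) (g v * (m v u * g u)) / N)).
      under eq_bigr => i _ do rewrite mxE mulr_suml.
      rewrite exchange_big; apply: eq_bigr => i _.
      rewrite (big_enum_val (fun u => g (enum_val i) * (m (enum_val i) u * g u) / N)).
      apply: eq_bigr => j _; rewrite !mxE -/(ev i) -/(ev j) !invfM.
      have : sq (ev i) / sq (ev i) = 1 by rewrite divff ?gt_eqF ?sqP.
      have : sq (ev j) / sq (ev j) = 1 by rewrite divff ?gt_eqF ?sqP.
      move: (sq (ev i)) (sq (ev j)) => a b hb ha.
      rewrite -[RHS]mulr1 -{1}ha -[RHS]mulr1 -{1}hb; ring.
    rewrite E1L mulrCA divff ?gt_eqF// mulr1; apply: eq_bigr => v vL.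
    have Nd : (d.+1 - #|v |: c|)%:R = N :> R.
      by move: vL; rewrite inE cardsU1 => /andP[-> _].
    rewrite /vertex_mean msum// Nd -/(deg v) -mulr_suml -mulr_sumr.
    rewrite !invfM; have : deg v / deg v = 1 by rewrite divff ?gt_eqF ?degP.
    move: (deg v) (\sum_(_ in _) _) => z y hz; rewrite -[LHS]mulr1 -hz; ring.
  rewrite normrM gtr0_norm// mulrCA ler_pM2l//.
(* The second endpoint of a random edge has the same law as the first. *)
have EgE : E1 c (fun v => E1 (v |: c) g) = 0.
  rewrite (E1_swap hX hw (fun _ => g))// -[RHS]g0; apply: (ex_eq hE) => u /andP[uc uX].
  by rewrite (ex_cst (E1_exp hX hw uX _))// cardsU1 uc.
have -> : E1 c (fun v => f v * E1 (v |: c) f) - E1 c f ^+ 2 = E1 c (fun v => g v * E1 (v |: c) g).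
  transitivity (E1 c (fun v => (g v * E1 (v |: c) g + t * E1 (v |: c) g) + t * f v) - t ^+ 2).
    congr (_ - _); apply: (ex_eq hE) => v /andP[vc vX].
    have cd' : (#|v |: c| <= d)%N by rewrite cardsU1 vc.
    have hv := E1_exp hX hw vX cd'.
    rewrite /g (exB hv) (ex_cst hv); ring.
  by rewrite !(exD hE) !(exZ hE) EgE -/t mulr0 addr0 expr2 addrK.
apply: le_trans gg _; rewrite (ex_variance hE).
by rewrite ler_wpM2l// lerBlDr lerDl sqr_ge0.
Qed.

End LinkGraph.

(** * Mixing inside links *)

Section Mixing.
Variables (R : rcfType) (V : finType) (X : {set {set V}}) (d : nat).
Variable (w : {set V} -> R).
Hypothesis hX : is_complex X d.
Hypothesis hw : is_weighting X d w.
Implicit Types (c a b s : {set V}) (u v : V).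
Local Notation mu := (mu X d w).
Local Notation E1 := (vertex_mean X d w).
Local Notation EE := (set_mean X d w).
Local Notation Es := (top_mean X d w).
Variable lam : R.
Hypothesis lam0 : 0 <= lam.
Hypothesis Hquad : forall c (f : V -> R), c \in X -> (#|c| < d)%N ->
  `|E1 c (fun v => f v * E1 (v |: c) f) - E1 c f ^+ 2| <= lam * E1 c (fun v => f v ^+ 2).

Lemma E1_setU1_exp c v : (#|c| < d)%N -> (v \notin c) && (v |: c \in X) ->
  expectation (fun u => (u \notin v |: c) && (u |: (v |: c) \in X)) (E1 (v |: c)).
Proof. by move=> cd /andP[vc vX]; apply: (E1_exp hX hw vX); rewrite cardsU1 vc. Qed.

(* Polarization; the additive right-hand side, in place of a product of norms, is what
   averages over links without the Cauchy-Schwarz inequality. *)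
Lemma link_bilinear c (f g : V -> R) : c \in X -> (#|c| < d)%N ->
  2 * `|E1 c (fun v => f v * E1 (v |: c) g) - E1 c f * E1 c g|
    <= lam * (E1 c (fun v => f v ^+ 2) + E1 c (fun v => g v ^+ 2)).
Proof.
move=> cX cd; have hE := E1_exp hX hw cX (ltnW cd).
have hEv v (hv : (v \notin c) && (v |: c \in X)) := E1_setU1_exp cd hv.
have sym : E1 c (fun v => g v * E1 (v |: c) f) = E1 c (fun v => f v * E1 (v |: c) g).
  transitivity (E1 c (fun v => E1 (v |: c) (fun u => g v * f u))).
    by apply: (ex_eq hE) => v /hEv h; rewrite (exZ h).
  rewrite (E1_swap hX hw)//; apply: (ex_eq hE) => v /hEv h.
  by rewrite (exZr h) mulrC.
have qD (e : R) : E1 c (fun v => (f v + e * g v) * E1 (v |: c) (fun u => f u + e * g u)) =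
    E1 c (fun v => f v * E1 (v |: c) f) + 2 * e * E1 c (fun v => f v * E1 (v |: c) g)
    + e ^+ 2 * E1 c (fun v => g v * E1 (v |: c) g).
  transitivity (E1 c (fun v => (f v * E1 (v |: c) f +
     (e * (f v * E1 (v |: c) g) + e * (g v * E1 (v |: c) f))) + e ^+ 2 * (g v * E1 (v |: c) g))).
    by apply: (ex_eq hE) => v /hEv h; rewrite (exD h) (exZ h); ring.
  by rewrite !(exD hE) !(exZ hE) sym; ring.
have sD (e : R) : E1 c (fun v => (f v + e * g v) ^+ 2) =
    E1 c (fun v => f v ^+ 2) + 2 * e * E1 c (fun v => f v * g v) + e ^+ 2 * E1 c (fun v => g v ^+ 2).
  transitivity (E1 c (fun v => (f v ^+ 2 + (2 * e) * (f v * g v)) + e ^+ 2 * g v ^+ 2)).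
    by apply: (ex_eq hE) => v _; ring.
  by rewrite !(exD hE) !(exZ hE).
have := Hquad (fun v => f v + 1 * g v) cX cd.
have := Hquad (fun v => f v + -1 * g v) cX cd.
rewrite !qD !sD !(exD hE) !(exZ hE) !ler_norml => /andP[h1 h2] /andP[h3 h4].
rewrite -[2]gtr0_norm// -normrM ler_norml; apply/andP; split; lra.
Qed.

Lemma card_added c k b : added X c k b -> #|b :|: c| = (#|c| + k)%N.
Proof.
by move=> /and3P[/eqP bk]; rewrite -leq_card_setU => /eqP -> _; rewrite bk addnC.
Qed.

Lemma E1_added_exp c k b : (#|c| + k <= d)%N -> added X c k b ->
  expectation (fun v => (v \notin b :|: c) && (v |: (b :|: c) \in X)) (E1 (b :|: c)).
Proof.
move=> ck hb; have [_ _ bX] := and3P hb.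
by apply: (E1_exp hX hw bX); rewrite (card_added hb).
Qed.

Lemma EE_setU1_exp c k v : (#|c| + k <= d)%N -> (v \notin c) && (v |: c \in X) ->
  expectation (added X (v |: c) k) (EE (v |: c) k).
Proof.
by move=> ck /andP[vc vX]; apply: (EE_exp hX hw vX); rewrite cardsU1 vc; lia.
Qed.

Lemma E1_EE_cst c k (F : {set V} -> R) : c \in X -> (#|c| + k <= d)%N ->
  E1 c (fun v => EE (v |: c) k F) = EE c k F.
Proof.
move=> cX ck; rewrite (EE_swap1 hX hw (fun _ => F)) ?addnS//.
have ck' : (#|c| + k <= d.+1)%N by lia.
apply: (ex_eq (EE_exp hX hw cX ck')) => b hb.
exact: (ex_cst (E1_added_exp ck hb)).
Qed.

Lemma EE_E1_cst c k (F : V -> R) : c \in X -> (#|c| + k <= d)%N ->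
  EE c k (fun b => E1 (b :|: c) F) = E1 c F.
Proof.
move=> cX ck; rewrite -(EE_swap1 hX hw (fun v _ => F v)) ?addnS//.
have ck' : (#|c| <= d)%N by lia.
apply: (ex_eq (E1_exp hX hw cX ck')) => v hv.
exact: (ex_cst (EE_setU1_exp ck hv)).
Qed.

(** The vertices of [a] are exposed one at a time. Each exposure leaves a covariance over the edges
    of one link, bounded by [link_bilinear]; hence the factor [i]. *)
Lemma swap_vertex_bound i c (f : {set V} -> R) (G : V -> R) : c \in X -> (#|c| + i <= d)%N ->
  2 * `|EE c i (fun a => f a * E1 (a :|: c) G) - EE c i f * E1 c G|
    <= i%:R * lam * (EE c i (fun a => f a ^+ 2) + E1 c (fun v => G v ^+ 2)).
Proof.
elim: i c f => [|i IH] c f cX ci; first by rewrite /= set0U subrr normr0 mulr0 !mul0r.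
have cd : (#|c| <= d)%N by lia.
have hE := E1_exp hX hw cX cd.
have ci' : (#|c| + i <= d)%N by lia.
have hEv v (hv : (v \notin c) && (v |: c \in X)) := EE_setU1_exp ci' hv.
rewrite !EES.
pose F v := EE (v |: c) i (fun b => f (v |: b)).
pose T v := EE (v |: c) i (fun b => f (v |: b) * E1 (b :|: (v |: c)) G).
have -> : E1 c (fun v => EE (v |: c) i (fun b => f (v |: b) * E1 (v |: b :|: c) G)) = E1 c T.
  apply: (ex_eq hE) => v hv; apply: (ex_eq (hEv v hv)) => b _.
  by rewrite setUCA setUA.
have cd' : (#|c| < d)%N by lia.
have b1 := link_bilinear F G cX cd'.
have b2 : 2 * `|E1 c T - E1 c (fun v => F v * E1 (v |: c) G)| <=
    i%:R * lam * (E1 c (fun v => EE (v |: c) i (fun b => f (v |: b) ^+ 2)) + E1 c (fun v => G v ^+ 2)).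
  have -> : E1 c (fun v => G v ^+ 2) = E1 c (fun v => E1 (v |: c) (fun v => G v ^+ 2)).
    rewrite -(@EE_E1_cst c 1 (fun v => G v ^+ 2))//; last by lia.
    by rewrite EES; apply: (ex_eq hE) => v _ /=; rewrite setU0.
  rewrite -(exB hE) -(exD hE) -(exZ hE).
  rewrite -[2]gtr0_norm// -normrM -(exZ hE) ler_norml -mulN1r -(exZ hE).
  have P v : (v \notin c) && (v |: c \in X) ->
      `|2 * (T v - F v * E1 (v |: c) G)| <= i%:R * lam *
       (EE (v |: c) i (fun b => f (v |: b) ^+ 2) + E1 (v |: c) (fun v => G v ^+ 2)).
    move=> /andP[vc vX]; rewrite normrM [`|2|]gtr0_norm//; apply: IH => //.
    by rewrite cardsU1 vc; lia.
  by apply/andP; split; apply: (ex_le hE) => v /P; rewrite ler_norml => /andP[h1 h2];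
    rewrite ?mulN1r.
have F2 : E1 c (fun v => F v ^+ 2) <= E1 c (fun v => EE (v |: c) i (fun b => f (v |: b) ^+ 2)).
  by apply: (ex_le hE) => v hv; apply: (ex_jensen (hEv v hv)).
rewrite -(natr1 i).
have := ler_wpM2l lam0 F2.
move: b1 b2; set A := E1 c T; set B := E1 c (fun v => F v * _); set C := E1 c F * _.
rewrite -/F -/C.
have := ler_normD (A - B) (B - C); rewrite subrKA => h1 h2 h3 h4.
nra.
Qed.

(* Localize at one vertex [v] of the [j.+1]-set: inside the link of [v |: c] the bound
   for [(i, j)] applies, and the remaining covariance is that of [f] with the
   vertex function [G]. *)
Lemma swap_bound i j c (f g : {set V} -> R) : c \in X -> (#|c| + i + j <= d.+1)%N ->
  2 * `|EE c i (fun a => f a * EE (a :|: c) j g) - EE c i f * EE c j g|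
    <= (i * j)%:R * lam * (EE c i (fun a => f a ^+ 2) + EE c j (fun b => g b ^+ 2)).
Proof.
elim: j c g => [|j IH] c g cX cij.
  have ci : (#|c| + i <= d.+1)%N by lia.
  by rewrite /= (exZr (EE_exp hX hw cX ci)) subrr normr0 muln0 mulr0 !mul0r.
have cd : (#|c| <= d)%N by lia.
have hE := E1_exp hX hw cX cd.
have ci : (#|c| + i <= d)%N by lia.
have cj : (#|c| + j <= d)%N by lia.
have hEj v (hv : (v \notin c) && (v |: c \in X)) := EE_setU1_exp cj hv.
have hEi v (hv : (v \notin c) && (v |: c \in X)) := EE_setU1_exp ci hv.
have ci' : (#|c| + i <= d.+1)%N by lia.
have hEE := EE_exp hX hw cX ci'.
rewrite ![EE c j.+1 _]EES.
pose G v := EE (v |: c) j (fun b => g (v |: b)).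
pose T v := EE (v |: c) i (fun a => f a * EE (a :|: (v |: c)) j (fun b => g (v |: b))).
have -> : EE c i (fun a => f a * EE (a :|: c) j.+1 g) = E1 c T.
  transitivity (EE c i (fun a => E1 (a :|: c)
      (fun v => f a * EE (v |: (a :|: c)) j (fun b => g (v |: b))))).
    by apply: (ex_eq hEE) => a ha; rewrite EES (exZ (E1_added_exp ci ha)).
  rewrite -(EE_swap1 hX hw (fun v a => f a * EE (v |: (a :|: c)) j (fun b => g (v |: b)))) ?addnS//.
  apply: (ex_eq hE) => v hv; apply: (ex_eq (hEi v hv)) => a _.
  by rewrite setUCA.
have b1 := swap_vertex_bound f G cX ci.
have b3 : EE c i (fun a => f a * E1 (a :|: c) G) = E1 c (fun v => EE (v |: c) i f * G v).
  transitivity (EE c i (fun a => E1 (a :|: c) (fun v => f a * G v))).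
    by apply: (ex_eq hEE) => a ha; rewrite (exZ (E1_added_exp ci ha)).
  rewrite -(EE_swap1 hX hw (fun v a => f a * G v)) ?addnS//.
  by apply: (ex_eq hE) => v hv; rewrite (exZr (hEi v hv)).
have b2 : 2 * `|E1 c T - E1 c (fun v => EE (v |: c) i f * G v)| <=
    (i * j)%:R * lam * (EE c i (fun a => f a ^+ 2)
      + E1 c (fun v => EE (v |: c) j (fun b => g (v |: b) ^+ 2))).
  rewrite -(@E1_EE_cst c i (fun a => f a ^+ 2))//.
  rewrite -(exB hE) -(exD hE) -(exZ hE).
  rewrite -[2]gtr0_norm// -normrM -(exZ hE) ler_norml -mulN1r -(exZ hE).
  have P v : (v \notin c) && (v |: c \in X) ->
      `|2 * (T v - EE (v |: c) i f * G v)| <= (i * j)%:R * lam *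
       (EE (v |: c) i (fun a => f a ^+ 2) + EE (v |: c) j (fun b => g (v |: b) ^+ 2)).
    move=> /andP[vc vX]; rewrite normrM [`|2|]gtr0_norm//; apply: IH => //.
    by rewrite cardsU1 vc; lia.
  by apply/andP; split; apply: (ex_le hE) => v /P; rewrite ler_norml => /andP[h1 h2];
    rewrite ?mulN1r.
have F2 : E1 c (fun v => G v ^+ 2) <= E1 c (fun v => EE (v |: c) j (fun b => g (v |: b) ^+ 2)).
  by apply: (ex_le hE) => v hv; apply: (ex_jensen (hEj v hv)).
have il0 : 0 <= i%:R * lam by rewrite mulr_ge0.
rewrite mulnS natrD.
have := ler_wpM2l il0 F2.
move: b1 b2; rewrite b3.
set A := E1 c T; set B := E1 c (fun v => _ * G v); set C := EE c i f * _.
rewrite -/G -/C.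
have := ler_normD (A - B) (B - C); rewrite subrKA => h1 h2 h3 h4.
nra.
Qed.

(** Viewing the nested mean as one expectation over pairs makes the variance and cross-term lemmas
    available for functions of [b] and [s] together. *)
Lemma face_pairs_exp c k : c \in X -> (#|c| + k <= d.+1)%N ->
  expectation (fun p => added X c k p.1 && ((p.2 \in faces X d.+1) && (p.1 :|: c \subset p.2)))
    (fun F : {set V} * {set V} -> R => EE c k (fun b => Es (b :|: c) (fun s => F (b, s)))).
Proof.
move=> cX ck.
apply: (@expectation_comp _ _ _ _ (fun b s => (s \in faces X d.+1) && (b :|: c \subset s))
  _ (fun b => Es (b :|: c)) (EE_exp hX hw cX ck)).
by move=> b /and3P[_ _ bX]; apply: Es_exp.
Qed.

(** In the expanded square, the [m] diagonal terms give [m^-1] times the second moment. The others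
    are correlations along a random edge of the link of [c], at most [lam] times the second moment
    since [psi] is centred. *)
Lemma sampled_average_bound c k (psi : V -> R) :
  let m := (d.+1 - (#|c| + k))%:R : R in
  c \in X -> (#|c| + k < d)%N -> E1 c psi = 0 ->
  EE c k (fun b => Es (b :|: c) (fun s => (m^-1 * \sum_(v in s :\: (b :|: c)) psi v) ^+ 2))
    <= (m^-1 + lam) * E1 c (fun v => psi v ^+ 2).
Proof.
move=> m cX ck psi0.
have cd : (#|c| <= d)%N by lia.
have cd' : (#|c| < d)%N by lia.
have ck' : (#|c| + k <= d)%N by lia.
have ck2 : (#|c| + k <= d.+1)%N by lia.
have hE := E1_exp hX hw cX cd.
have hEE := EE_exp hX hw cX ck2.
have m0 : 0 < m by rewrite ltr0n; lia.
have -> : EE c k (fun b => Es (b :|: c) (fun s => (m^-1 * \sum_(v in s :\: (b :|: c)) psi v) ^+ 2))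
  = E1 c (fun v => m^-1 * psi v ^+ 2 + m^-1 * (m - 1) * (psi v * E1 (v |: c) psi)).
  transitivity (EE c k (fun b => E1 (b :|: c) (fun v => Es (v |: (b :|: c))
      (fun s => psi v * (m^-1 * \sum_(u in s :\: (b :|: c)) psi u))))).
    apply: (ex_eq hEE) => b hb; have [_ _ bX] := and3P hb.
    rewrite (E1_Es hX hw)// (card_added hb) -/m; apply: (ex_eq (Es_exp hX hw bX)) => s _.
    by rewrite -mulr_suml mulrA -expr2.
  transitivity (EE c k (fun b => E1 (b :|: c) (fun v =>
      m^-1 * psi v ^+ 2 + m^-1 * (m - 1) * (psi v * E1 (v |: (b :|: c)) psi)))).
    apply: (ex_eq hEE) => b hb; apply: (ex_eq (E1_added_exp ck' hb)) => v /andP[vbc vX].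
    have hs := Es_exp hX hw vX.
    rewrite -[X in _ + X]mulrA.
    have -> : (m - 1) * (psi v * E1 (v |: (b :|: c)) psi) =
       Es (v |: (b :|: c)) (fun s => psi v * \sum_(u in s :\: (v |: (b :|: c))) psi u).
      have hv : (#|v |: (b :|: c)| <= d)%N by rewrite cardsU1 vbc (card_added hb); lia.
      rewrite (exZ hs) mulrCA; congr (_ * _).
      transitivity ((m - 1) * E1 (v |: (b :|: c)) (fun u => Es (u |: (v |: (b :|: c))) (fun=> psi u))).
        congr (_ * _); apply: (ex_eq (E1_exp hX hw vX hv)) => u /andP[_ uX].
        by rewrite (ex_cst (Es_exp hX hw uX)).
      rewrite (E1_Es hX hw)// -(exZ hs); apply: (ex_eq hs) => s _.
      rewrite mulrA cardsU1 vbc (card_added hb).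
      have -> : (d.+1 - (true + (#|c| + k)))%:R = m - 1 :> R.
        have -> : m = (d - (#|c| + k)).+1%:R by congr (_%:R); lia.
        by rewrite -natr1 addrK.
      by rewrite mulfV ?mul1r// gt_eqF// subr_gt0 -[1]/(1%:R) ltr_nat; lia.
    rewrite -(exZ hs) -[X in X + _](ex_cst hs) -(exD hs).
    apply: (ex_eq hs) => s /andP[_ /subsetP vs].
    rewrite (bigD1 v) /=; last by rewrite inE vbc vs// !inE eqxx.
    rewrite mulrDr mulrDr expr2; congr (_ + _); first by ring.
    rewrite mulrCA; congr (_ * (_ * _)); apply: eq_bigl => u.
    by rewrite !inE; case: (u == v); rewrite ?andbT ?andbF.
  rewrite -(EE_swap1 hX hw (fun v b => m^-1 * psi v ^+ 2 + m^-1 * (m - 1) * (psi v * E1 (v |: (b :|: c)) psi))) ?addnS//.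
  apply: (ex_eq hE) => v hv; have hEv := EE_setU1_exp ck' hv.
  have [vc vX] := andP hv.
  rewrite (exD hEv) (ex_cst hEv) (exZ hEv) (exZ hEv); congr (_ + _ * (_ * _)).
  rewrite -[RHS](@EE_E1_cst _ k)//; last by rewrite cardsU1 vc; lia.
  by apply: (ex_eq hEv) => b _; rewrite setUCA.
rewrite (exD hE) !(exZ hE).
have := Hquad psi cX cd'; rewrite psi0 expr0n subr0 ler_norml => /andP[_ h].
rewrite mulrDl lerD2l.
have m1 : 1 <= m by rewrite -[1]/(1%:R) ler_nat; lia.
have hm : 0 <= m^-1 * (m - 1) <= 1.
  rewrite mulr_ge0 ?invr_ge0 ?subr_ge0 ?(ltW m0)//= mulrBr mulVf ?gt_eqF// mulr1.
  by rewrite lerBlDr lerDl invr_ge0 ltW.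
case/andP: hm => hm0 hm1.
have hp : 0 <= lam * E1 c (fun v => psi v ^+ 2).
  by rewrite mulr_ge0// (ex_ge0 hE)// => v _; apply: sqr_ge0.
by apply: le_trans (ler_wpM2l hm0 h) _; rewrite -[leRHS]mul1r ler_wpM2r.
Qed.

(* With [phi = E[F | v]] centred, [E phi^2] is the correlation of [F] with the average
   of [phi] over the [m] vertices of [s] outside [b :|: c], which is small in norm. *)
Lemma sampler_variance c k (F : {set V} -> {set V} -> R) :
  let m := (d.+1 - (#|c| + k))%:R : R in
  let phi v := EE (v |: c) k (fun b => Es (b :|: (v |: c)) (F b)) in
  let tau := EE c k (fun b => Es (b :|: c) (F b)) in
  c \in X -> (#|c| + k < d)%N ->
  E1 c phi = tau /\
  E1 c (fun v => phi v ^+ 2) - tau ^+ 2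
    <= (m^-1 + lam) * (EE c k (fun b => Es (b :|: c) (fun s => F b s ^+ 2)) - tau ^+ 2).
Proof.
move=> m phi tau cX ck.
have cd : (#|c| <= d)%N by lia.
have ck' : (#|c| + k <= d)%N by lia.
have ck2 : (#|c| + k <= d.+1)%N by lia.
have hE := E1_exp hX hw cX cd.
have hEE := EE_exp hX hw cX ck2.
have hp := face_pairs_exp cX ck2.
have m0 : 0 < m by rewrite ltr0n; lia.
have L0 : 0 < m^-1 + lam by rewrite ltr_wpDr// invr_gt0.
have push (psi : V -> R) : E1 c (fun v => psi v * phi v) =
   EE c k (fun b => E1 (b :|: c) (fun v => Es (v |: (b :|: c)) (fun s => psi v * F b s))).
  rewrite -(EE_swap1 hX hw (fun v b => Es (v |: (b :|: c)) (fun s => psi v * F b s))) ?addnS//.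
  apply: (ex_eq hE) => v hv; have hEv := EE_setU1_exp ck' hv.
  rewrite -(exZ hEv); apply: (ex_eq hEv) => b /and3P[_ _ bX].
  by rewrite [v |: (b :|: c)]setUCA (exZ (Es_exp hX hw bX)).
have phi_mean : E1 c phi = tau.
  transitivity (E1 c (fun v => 1 * phi v)); first by apply: (ex_eq hE) => v _; rewrite mul1r.
  rewrite push; apply: (ex_eq hEE) => b hb; have [_ _ bX] := and3P hb.
  rewrite (Es_tower1 hX hw)//; last by rewrite (card_added hb).
  apply: (ex_eq (E1_added_exp ck' hb)) => v /andP[_ vX].
  by apply: (ex_eq (Es_exp hX hw vX)) => s _; rewrite mul1r.
split=> //.
pose psi v := phi v - tau.
have psi0 : E1 c psi = 0 by rewrite (exB hE) (ex_cst hE) phi_mean subrr.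
pose A b s := m^-1 * \sum_(v in s :\: (b :|: c)) psi v.
have A2 := sampled_average_bound cX ck psi0.
rewrite -/m in A2.
have varphi : E1 c (fun v => phi v ^+ 2) - tau ^+ 2 = E1 c (fun v => psi v ^+ 2).
  by rewrite -phi_mean -(ex_variance hE) phi_mean.
have varF : EE c k (fun b => Es (b :|: c) (fun s => F b s ^+ 2)) - tau ^+ 2 =
   EE c k (fun b => Es (b :|: c) (fun s => (F b s - tau) ^+ 2)).
  exact/esym/(ex_variance hp (fun p => F p.1 p.2)).
have cross : E1 c (fun v => psi v ^+ 2) =
   EE c k (fun b => Es (b :|: c) (fun s => A b s * (F b s - tau))).
  transitivity (E1 c (fun v => psi v * phi v - psi v * tau)).
    by apply: (ex_eq hE) => v _; rewrite /psi; ring.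
  rewrite (exB hE) (exZr hE) psi0 mul0r subr0 push.
  transitivity (EE c k (fun b => Es (b :|: c) (fun s => A b s * F b s))).
    apply: (ex_eq hEE) => b hb; have [_ _ bX] := and3P hb.
    rewrite (E1_Es hX hw)// (card_added hb) -/m; apply: (ex_eq (Es_exp hX hw bX)) => s _.
    by rewrite -mulr_suml mulrA.
  have A0 : EE c k (fun b => Es (b :|: c) (fun s => A b s)) = 0.
    rewrite -[RHS]psi0 -(@EE_E1_cst c k)//; apply: (ex_eq hEE) => b hb.
    have [_ _ bX] := and3P hb.
    transitivity (E1 (b :|: c) (fun v => Es (v |: (b :|: c)) (fun=> psi v))).
      by rewrite (E1_Es hX hw)// (card_added hb).
    apply: (ex_eq (E1_added_exp ck' hb)) => v /andP[_ vX].
    by rewrite (ex_cst (Es_exp hX hw vX)).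
  have e1 := exZr hp tau (fun p => A p.1 p.2); rewrite /= A0 mul0r in e1.
  have e2 := exB hp (fun p => A p.1 p.2 * F p.1 p.2) (fun p => A p.1 p.2 * tau).
  rewrite /= e1 subr0 in e2; rewrite -e2.
  apply: (ex_eq hEE) => b /and3P[_ _ bX]; apply: (ex_eq (Es_exp hX hw bX)) => s _; ring.
rewrite varphi varF.
(* With weight [L = m^-1 + lam] and [x] the variance of [phi], this reads
   [2 L x <= E A^2 + L^2 Var F]; by [A2] the term [E A^2] is at most [L x] and is absorbed. *)
have := ex_cross hp (fun p => A p.1 p.2) (fun p => F p.1 p.2 - tau) (m^-1 + lam).
rewrite /= -cross => h; rewrite -(ler_pM2l L0); move: h A2.
set x := E1 c _; set y := EE c k _; set z := EE c k _; set L := (m^-1 + lam).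
by move=> h1 h2; lra.
Qed.

End Mixing.

(** * Averaging over a finite probability space *)

Section FiniteExpectation.
Variables (R : rcfType) (T : finType) (S : T -> bool) (E : (T -> R) -> R).
Hypothesis hE : expectation S E.

(** The minimizer of [phi] on [P] does at least as well as the conditional mean given [P]; this
    replaces a random choice by a fixed representative. *)
Lemma ex_exists_le (P : pred T) (phi : T -> R) : 0 < E (fun x => (P x)%:R) ->
  exists x, [/\ S x, P x & phi x * E (fun x => (P x)%:R) <= E (fun x => (P x)%:R * phi x)].
Proof.
move=> hP; have [x0 hx0] : exists x, S x && P x.
  apply/existsP; rewrite -[X in is_true X]negbK negb_exists; apply/negP => /forallP h.
  suff : E (fun x => (P x)%:R) <= E (fun=> 0).
    by rewrite (ex_cst hE) leNgt hP.
  apply: (ex_le hE) => x Sx; have := h x; rewrite Sx /=.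
  by case: (P x).
case: (@arg_minP _ _ _ x0 (fun x => S x && P x) phi hx0) => x /andP[Sx Px] xmin.
exists x; split=> //; rewrite -(exZ hE); apply: (ex_le hE) => y Sy.
case: (boolP (P y)) => Py; last by rewrite mulr0 mul0r.
by rewrite mulr1 mul1r xmin ?Sy.
Qed.

Lemma ex_collision (K : finType) (k : T -> K) :
  E (fun x => E (fun y => (k x == k y)%:R)) = \sum_z E (fun x => (k x == z)%:R) ^+ 2.
Proof.
transitivity (E (fun x => \sum_z (k x == z)%:R * E (fun y => (k y == z)%:R))).
  apply: (ex_eq hE) => x _; rewrite (bigD1 (k x)) //= eqxx mul1r big1 ?addr0.
    by apply: (ex_eq hE) => y _; rewrite eq_sym.
  by move=> z; rewrite eq_sym => /negbTE ->; rewrite mul0r.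
rewrite (ex_sum hE); apply: eq_bigr => z _.
by rewrite (exZr hE) expr2.
Qed.

End FiniteExpectation.

(** * Means over the faces of the whole complex *)

Section Faces.
Variables (R : rcfType) (V : finType) (X : {set {set V}}) (d : nat).
Variable (w : {set V} -> R).
Hypothesis hX : is_complex X d.
Hypothesis hw : is_weighting X d w.
Implicit Types (c a b s t : {set V}) (u v : V).
Local Notation mu := (mu X d w).
Local Notation E1 := (vertex_mean X d w).
Local Notation EE := (set_mean X d w).
Local Notation Es := (top_mean X d w).

Lemma added0 k a : added X set0 k a = (a \in faces X k).
Proof. by rewrite /added disjoint_sym disjoints_subset sub0set setU0 inE andbC. Qed.

Lemma EE0_exp k : (k <= d.+1)%N -> expectation (fun a => a \in faces X k) (EE set0 k).
Proof.
move=> kd; have kd' : (#|@set0 V| + k <= d.+1)%N by rewrite cards0.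
have h := EE_exp hX hw (set0X hX hw) kd'.
split; [exact: exD h|exact: exZ h| |exact: ex1 h].
by move=> f f0; apply: (ex_ge0 h) => a; rewrite added0; apply: f0.
Qed.

Lemma EE0_recr k (F : {set V} -> R) : (k <= d)%N ->
  EE set0 k.+1 F = EE set0 k (fun a => E1 a (fun v => F (v |: a))).
Proof.
move=> kd; rewrite (EE_recr hX hw) ?cards0//; last exact: set0X hX hw.
by apply: (ex_eq (EE0_exp (leqW kd))) => a _; rewrite setU0.
Qed.

Lemma EE0_swap i j (F : {set V} -> {set V} -> R) : (i + j <= d.+1)%N ->
  EE set0 i (fun a => EE a j (F a)) = EE set0 j (fun b => EE b i (fun a => F a b)).
Proof.
move=> ij; have id : (i <= d.+1)%N by lia.
have jd : (j <= d.+1)%N by lia.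
transitivity (EE set0 i (fun a => EE (a :|: set0) j (F a))).
  by apply: (ex_eq (EE0_exp id)) => a _; rewrite setU0.
rewrite (EE_swap hX hw) ?cards0//; last exact: set0X hX hw.
by apply: (ex_eq (EE0_exp jd)) => a _; rewrite setU0.
Qed.

Lemma EE0_swap1 k (F : V -> {set V} -> R) : (k <= d)%N ->
  E1 set0 (fun v => EE [set v] k (F v)) = EE set0 k (fun a => E1 a (fun v => F v a)).
Proof.
move=> kd; have c0 : (#|@set0 V| <= d)%N by rewrite cards0.
transitivity (E1 set0 (fun v => EE (v |: set0) k (F v))).
  by apply: (ex_eq (E1_exp hX hw (set0X hX hw) c0)) => v _; rewrite setU0.
rewrite (EE_swap1 hX hw) ?cards0//; last exact: set0X hX hw.
by apply: (ex_eq (EE0_exp (leqW kd))) => a _; rewrite setU0.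
Qed.

Lemma EE0_sum_in k (f : {set V} -> V -> R) : (k <= d)%N ->
  EE set0 k.+1 (fun t => \sum_(v in t) f (t :\ v) v) =
  k.+1%:R * EE set0 k (fun a => E1 a (f a)).
Proof.
move=> kd; rewrite (EE_sum_in hX hw) ?cards0//; last exact: set0X hX hw.
by congr (_ * _); apply: (ex_eq (EE0_exp (leqW kd))) => a _; rewrite setU0.
Qed.

(** Links the vertex-by-vertex draw to the measure in the definition of the test. A face of size
    [k.+1] arises once for each choice of its last vertex, and [mul_bin_left] matches the
    binomials. *)
Lemma EE0_prob_face k (F : {set V} -> R) : (k <= d.+1)%N ->
  EE set0 k F = \sum_(t in faces X k) prob_face X d w t * F t.
Proof.
elim: k F => [|k IH] F kd.
  rewrite (big_pred1 set0) /=; last first.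
    by move=> t; rewrite !inE cards_eq0; case: eqP => [->|_]; rewrite ?andbF// (set0X hX hw).
  by rewrite /prob_face -mulr_suml -/(mu set0) (mu0 hw) cards0 bin0 divr1 mul1r.
rewrite EE0_recr// IH; last exact: ltnW.
have pf t : t \in faces X k.+1 -> prob_face X d w t * F t
   = \sum_(v in t) mu t * F t / ('C(d.+1, k)%:R * (d.+1 - k)%:R).
  rewrite inE => /andP[_ /eqP tk]; rewrite sumr_const tk.
  rewrite /prob_face -mulr_suml -/(mu t) tk -natrM mulnC -mul_bin_left natrM.
  rewrite -[RHS]mulr_natl invfM; have : k.+1%:R / k.+1%:R = 1 :> R by rewrite divff// pnatr_eq0.
  move: (k.+1%:R) => z hz; rewrite -[LHS]mulr1 -hz; ring.
rewrite [RHS](eq_bigr _ pf) pair_big_dep /=.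
have lf a : a \in faces X k -> prob_face X d w a * E1 a (fun v => F (v |: a))
   = \sum_(v | (v \notin a) && (v |: a \in X)) mu (v |: a) * F (v |: a) / ('C(d.+1, k)%:R * (d.+1 - k)%:R).
  rewrite inE => /andP[aX /eqP ak].
  rewrite /prob_face -mulr_suml -/(mu a) /vertex_mean ak.
  rewrite (bigID (fun v => v |: a \in X)) /= [X in _ + X]big1 ?addr0; last first.
    by move=> v /andP[_ h]; rewrite (mu_notin _ hX h) mul0r.
  rewrite -mulr_suml !invfM; have : mu a / mu a = 1 by rewrite divff// gt_eqF// (mu_gt0 hX hw).
  move: (\sum_(_ | _) _) (mu a) => y z hz; rewrite -[RHS]mulr1 -hz; ring.
rewrite (eq_bigr _ lf) pair_big_dep /=.
rewrite (reindex_onto (fun p : {set V} * V => (p.1 :\ p.2, p.2))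
   (fun p : {set V} * V => (p.2 |: p.1, p.2))) /=; last first.
  by move=> [a v] /= /andP[_ /andP[va _]]; rewrite setU1K.
apply: eq_big => [[t v]|[t v] /andP[/andP[_ _] /eqP[e]]] /=; last by rewrite e.
rewrite !inE eqxx /= xpair_eqE eqxx andbT.
case: (boolP (v \in t)) => vt; last first.
  rewrite andbF; apply/negP => /andP[_ /eqP e]; move: vt; rewrite -e !inE eqxx //.
rewrite setD1K// eqxx !andbT; have := cardsD1 v t; rewrite vt => ->.
rewrite add1n eqSS; case: (boolP (t \in X)) => tX; last by rewrite !andbF.
by rewrite (hX.1 _ _ tX (subsetDl _ _)) andbT.
Qed.

Lemma EE0_Es k (F : {set V} -> {set V} -> R) : (k <= d.+1)%N ->
  EE set0 k (fun a => Es a (F a)) = \sum_(s in faces X d.+1) w s *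
     ('C(d.+1, k)%:R^-1 * \sum_(a : {set V} | (a \subset s) && (#|a| == k)) F a s).
Proof.
move=> kd; rewrite EE0_prob_face//.
have e t : t \in faces X k -> prob_face X d w t * Es t (F t) =
   \sum_(s in faces X d.+1 | t \subset s) w s * ('C(d.+1, k)%:R^-1 * F t s).
  rewrite inE => /andP[tX /eqP tk]; rewrite /prob_face -mulr_suml -/(mu t) tk /top_mean.
  have : mu t / mu t = 1 by rewrite divff// gt_eqF// (mu_gt0 hX hw).
  transitivity ('C(d.+1, k)%:R^-1 * \sum_(s in faces X d.+1 | t \subset s) w s * F t s).
    move: (\sum_(_ in _ | _) _) (mu t) H => y z hz; rewrite -[RHS]mulr1 -hz; ring.
  rewrite mulr_sumr; apply: eq_bigr => s _; ring.
rewrite (eq_bigr _ e) (exchange_big_dep (fun s => s \in faces X d.+1)) /=; last first.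
  by move=> t s _ /andP[].
apply: eq_bigr => s hs; rewrite -!mulr_sumr; congr (_ * (_ * _)).
apply: eq_bigl => t; rewrite hs /= inE.
case: (boolP (t \subset s)) => ts; last by rewrite andbF.
by rewrite (hX.1 _ _ (topP hs).1 ts) andbT.
Qed.

(** * The effect of revealing one vertex *)

Section Sampler.
Variable lam : R.
Hypothesis lam0 : 0 <= lam.
Hypothesis Hquad : forall c (f : V -> R), c \in X -> (#|c| < d)%N ->
  `|E1 c (fun v => f v * E1 (v |: c) f) - E1 c f ^+ 2| <= lam * E1 c (fun v => f v ^+ 2).

Lemma sampler_top c (F : {set V} -> R) : c \in X -> (#|c| < d)%N ->
  E1 c (fun v => Es (v |: c) F ^+ 2) - Es c F ^+ 2
    <= ((d.+1 - #|c|)%:R^-1 + lam) * (Es c (fun s => F s ^+ 2) - Es c F ^+ 2).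
Proof.
move=> cX cd; have cd0 : (#|c| + 0 < d)%N by rewrite addn0.
have [_] := sampler_variance hX hw lam0 Hquad (fun _ => F) cX cd0.
rewrite /= !set0U addn0; apply: le_trans; rewrite lerD2r.
apply: (ex_le (E1_exp hX hw cX (ltnW cd))) => v _.
by rewrite set0U.
Qed.

(** By [sampler_top] applied to the indicator of each label, revealing [v] raises the mean collision
    probability [\sum_z p z ^ 2] by at most [L] times [1 - \sum_z p z ^ 2]. Disagreement thus keeps
    a fraction [1 - L], at least one half. *)
Lemma label_disagreement (K : finType) (k : {set V} -> K) c : c \in X -> (#|c| < d)%N ->
  (d.+1 - #|c|)%:R^-1 + lam <= 2^-1 ->
  Es c (fun s1 => Es c (fun s2 => (k s1 != k s2)%:R))
  <= 2 * E1 c (fun v => Es (v |: c) (fun s1 => Es (v |: c) (fun s2 => (k s1 != k s2)%:R))).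
Proof.
move=> cX cd hL.
have neg c' : c' \in X -> Es c' (fun s1 => Es c' (fun s2 => (k s1 != k s2)%:R)) =
    1 - \sum_z Es c' (fun x => (k x == z)%:R) ^+ 2.
  move=> cX'; have h := Es_exp hX hw cX'.
  rewrite -(ex_collision h) -[X in _ = X - _](ex1 h) -(exB h); apply: (ex_eq h) => s _.
  rewrite -[X in _ = X - _](ex1 h) -(exB h); apply: (ex_eq h) => s' _.
  by case: (k s == k s') => /=; rewrite ?subrr ?subr0.
have hE := E1_exp hX hw cX (ltnW cd).
rewrite neg//.
have -> : E1 c (fun v => Es (v |: c) (fun s1 => Es (v |: c) (fun s2 => (k s1 != k s2)%:R)))
   = 1 - \sum_z E1 c (fun v => Es (v |: c) (fun x => (k x == z)%:R) ^+ 2).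
  rewrite -(ex_sum hE) -[X in _ = X - _](ex1 hE) -(exB hE); apply: (ex_eq hE) => v /andP[_ vX].
  by rewrite neg// (ex1 hE).
set L := (_ + lam) in hL.
have h := Es_exp hX hw cX.
pose p z := Es c (fun x => (k x == z)%:R).
have p1 : \sum_z p z = 1.
  rewrite -(ex_sum h) -[RHS](ex1 h); apply: (ex_eq h) => s _.
  rewrite (bigD1 (k s))//= eqxx big1 ?addr0// => z; rewrite eq_sym => /negbTE -> //.
have : \sum_z E1 c (fun v => Es (v |: c) (fun x => (k x == z)%:R) ^+ 2)
   <= \sum_z (p z ^+ 2 + L * (p z - p z ^+ 2)).
  apply: ler_sum => z _; rewrite -lerBlDl.
  apply: le_trans (sampler_top (fun x => (k x == z)%:R) cX cd) _.
  have -> : Es c (fun s => (k s == z)%:R ^+ 2) = p z.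
    by apply: (ex_eq h) => s _; case: (_ == _); rewrite ?expr1n ?expr0n.
  by [].
rewrite big_split /= -mulr_sumr sumrB p1.
have : 0 <= 1 - \sum_z p z ^+ 2.
  rewrite -neg//; apply: (ex_ge0 h) => s _; apply: (ex_ge0 h) => s' _; exact: ler0n.
move=> h1 h2; nra.
Qed.

(** A Boolean [F] has second moment [tau], so the variance over [v] is at most [K * tau], and
    exceeding [theta] is a deviation of at least [theta / 2]. The bound is linear in [tau], so it
    can be averaged over [c]. *)
Lemma chebyshev c k (F : {set V} -> {set V} -> bool) (theta K : R) :
  let phi v := EE (v |: c) k (fun b => Es (b :|: (v |: c)) (fun s => (F b s)%:R)) in
  let tau := EE c k (fun b => Es (b :|: c) (fun s => (F b s)%:R)) in
  c \in X -> (#|c| + k < d)%N -> 0 < theta -> tau <= theta / 2 ->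
  (d.+1 - (#|c| + k))%:R^-1 + lam <= K ->
  E1 c (fun v => (theta < phi v)%R%:R) <= 4 / theta ^+ 2 * (K * tau).
Proof.
move=> phi tau cX ck th0 tauth hK.
have cd : (#|c| <= d)%N by lia.
have ck2 : (#|c| + k <= d.+1)%N by lia.
have hE := E1_exp hX hw cX cd.
have hp := face_pairs_exp hX hw cX ck2.
have [phim] := sampler_variance hX hw lam0 Hquad (fun b s => (F b s)%:R) cX ck.
rewrite -/phi -/tau in phim *.
have -> : EE c k (fun b => Es (b :|: c) (fun s => (F b s)%:R ^+ 2)) = tau.
  apply: (ex_eq (EE_exp hX hw cX ck2)) => b /and3P[_ _ bX].
  by apply: (ex_eq (Es_exp hX hw bX)) => s _; case: (F b s); rewrite ?expr1n ?expr0n.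
move=> hvar.
have tau0 : 0 <= tau.
  apply: (ex_ge0 (EE_exp hX hw cX ck2)) => b /and3P[_ _ bX].
  apply: (ex_ge0 (Es_exp hX hw bX)) => s _; exact: ler0n.
have L0 : 0 <= (d.+1 - (#|c| + k))%:R^-1 + lam by rewrite addr_ge0// invr_ge0.
have bound : E1 c (fun v => (phi v - tau) ^+ 2) <= K * tau.
  rewrite -phim (ex_variance hE) phim; apply: le_trans hvar _.
  apply: le_trans (_ : _ <= ((d.+1 - (#|c| + k))%:R^-1 + lam) * tau) _.
    by rewrite ler_wpM2l// lerBlDr lerDl sqr_ge0.
  by rewrite ler_wpM2r.
have c0 : 0 <= 4 / theta ^+ 2 by rewrite divr_ge0// sqr_ge0.
apply: le_trans (ler_wpM2l c0 bound).
rewrite -(exZ hE); apply: (ex_le hE) => v _.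
case: ltP => hv; last by rewrite mulr_ge0// sqr_ge0.
rewrite mulrAC ler_pdivlMr ?exprn_gt0// mul1r.
have : theta / 2 <= phi v - tau by lra.
move=> h; have h2 : 0 <= theta / 2 by lra.
have := ler_pM h2 h2 h h; rewrite -!expr2 expr_div_n; nra.
Qed.

End Sampler.
End Faces.

Section Sizes.
Local Open Scope nat_scope.
Lemma double_lt_le l d : l + l < d -> l <= d.
Proof. lia. Qed.
Lemma double_lt_lt l d : l + l < d -> l < d.
Proof. lia. Qed.
Lemma double_lt_subS l d : l + l < d -> d.+1 <= (d.+1 - l) * 2.
Proof. lia. Qed.
End Sizes.

(** * The agreement test *)

Section Agreement.
Variables (R : rcfType) (V Sigma : finType) (X : {set {set V}}) (d l : nat).
Variable (w : {set V} -> R).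
Hypothesis hX : is_complex X d.
Hypothesis hw : is_weighting X d w.
Implicit Types (c a b s t : {set V}) (u v : V).
Local Notation E1 := (vertex_mean X d w).
Local Notation EE := (set_mean X d w).
Local Notation Es := (top_mean X d w).
Variables lam K : R.
Hypothesis lam0 : 0 < lam.
Hypothesis Hquad : forall c (h : V -> R), c \in X -> (#|c| < d)%N ->
  `|E1 c (fun v => h v * E1 (v |: c) h) - E1 c h ^+ 2| <= lam * E1 c (fun v => h v ^+ 2).
Hypothesis l0 : (0 < l)%N.
Hypothesis l2 : (l + l < d)%N.
Hypothesis hK : (d.+1 - (l + l))%:R^-1 + lam <= K / l%:R.
Hypothesis hhalf : (d.+1 - l)%:R^-1 + lam <= 2^-1.
Hypothesis hmix : (l * l)%:R * lam <= 9^-1.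
Hypothesis hmix2 : ((l * l)%:R * lam) ^+ 2 <= l%:R^-1.
Variable f : {set V} -> V -> Sigma.

Let lWd : (l <= d)%N := double_lt_le l2.
Let lW : (l <= d.+1)%N := leqW lWd.
Let ltld : (l < d)%N := double_lt_lt l2.
Let l1 : (l.+1 <= d.+1)%N := leqW ltld.

Definition Eface := EE0_exp hX hw lW.

Lemma Evert a : a \in faces X l -> expectation (fun v => (v \notin a) && (v |: a \in X)) (E1 a).
Proof. by rewrite inE => /andP[aX /eqP al]; apply: (E1_exp hX hw aX); rewrite al. Qed.

Lemma face_exp a : a \in faces X l -> expectation (fun s => (s \in faces X d.+1) && (a \subset s)) (Es a).
Proof. by rewrite inE => /andP[aX _]; apply: (Es_exp hX hw aX). Qed.

Let hK0 : (d.+1 - l)%:R^-1 + lam <= K / l%:R.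
Proof.
apply: le_trans hK; rewrite lerD2r lef_pV2 ?posrE ?ltr0n ?subn_gt0 ?ltnS//.
  by rewrite ler_nat leq_sub2l// leq_addr.
exact: ltnW.
Qed.

(** The law of a random face with [l.+1] vertices in which one uniformly chosen vertex [v] is
    singled out. *)
Definition EAV (F : {set V} -> V -> R) := EE set0 l (fun a => E1 a (F a)).

Lemma EAV_le F G : (forall a v, a \in faces X l -> v \notin a -> v |: a \in X -> F a v <= G a v) ->
  EAV F <= EAV G.
Proof.
move=> h; apply: (ex_le Eface) => a ha; apply: (ex_le (Evert ha)) => v /andP[va vX].
exact: h.
Qed.

Lemma EAV_D F G : EAV (fun a v => F a v + G a v) = EAV F + EAV G.
Proof.
by rewrite -(exD Eface); apply: (ex_eq Eface) => a ha; rewrite (exD (Evert ha)).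
Qed.

Lemma EAV_Z x F : EAV (fun a v => x * F a v) = x * EAV F.
Proof.
by rewrite -(exZ Eface); apply: (ex_eq Eface) => a ha; rewrite (exZ (Evert ha)).
Qed.

Lemma EAV_cst F : EAV (fun a _ => F a) = EE set0 l F.
Proof. by apply: (ex_eq Eface) => a ha; rewrite (ex_cst (Evert ha)). Qed.

Definition differ a s1 s2 := ~~ [forall v in a, f s1 v == f s2 v].

Lemma differP a s1 s2 : reflect (exists2 v, v \in a & f s1 v != f s2 v) (differ a s1 s2).
Proof.
rewrite /differ negb_forall; apply: (iffP existsP) => [[v]|[v va h]].
  by rewrite negb_imply => /andP[va h]; exists v.
by exists v; rewrite negb_imply va.
Qed.

Lemma differU1 v a s1 s2 : differ (v |: a) s1 s2 = (f s1 v != f s2 v) || differ a s1 s2.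
Proof.
apply/differP/orP => [[u]|[h|/differP[u ua h]]].
- by rewrite !inE => /orP[/eqP -> ->|ua h]; [left|right; apply/differP; exists u].
- by exists v => //; rewrite !inE eqxx.
- by exists u => //; rewrite !inE ua orbT.
Qed.

Lemma differ_trans a s1 s2 s3 : ~~ differ a s1 s2 -> ~~ differ a s1 s3 -> ~~ differ a s2 s3.
Proof.
move=> /negPn/forallP h1 /negPn/forallP h2; apply/negPn/forallP => v.
by apply/implyP => va; move: (h1 v) (h2 v); rewrite va => /eqP <- /eqP <-.
Qed.

(** The compared set [a] is kept apart from the conditioning face [t]: the test conditions on
    [v |: a] even where only the values on [a] matter. *)
Definition pair_differ a t := Es t (fun s1 => Es t (fun s2 => (differ a s1 s2)%:R)).
Definition eps := EE set0 l.+1 (fun t => pair_differ t t).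

Lemma eps_ge0 : 0 <= eps.
Proof.
apply: (ex_ge0 (EE0_exp hX hw l1)) => t; rewrite inE => /andP[tX _].
apply: (ex_ge0 (Es_exp hX hw tX)) => s1 _; apply: (ex_ge0 (Es_exp hX hw tX)) => s2 _.
exact: ler0n.
Qed.

Lemma eps_EAV : eps = EAV (fun a v => pair_differ (v |: a) (v |: a)).
Proof. by rewrite /eps (EE0_recr hX hw) ?lWd. Qed.

Lemma base_disagreement : EAV (fun a v => pair_differ a (v |: a)) <= eps.
Proof.
rewrite eps_EAV; apply: EAV_le => a v ha va vX.
apply: (ex_le (Es_exp hX hw vX)) => s1 _; apply: (ex_le (Es_exp hX hw vX)) => s2 _.
by rewrite differU1 ler_nat; case: differ; rewrite ?orbT.
Qed.

(** Two top faces drawn given [a] need not share a further vertex, as those of the test do;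
    [label_disagreement], with the restriction to [a] as label, bridges this at the cost of a factor
    2. Averaging over the first face then fixes [s0 a]. *)
Lemma popular_exists : exists s0 : {set V} -> {set V},
  EE set0 l (fun a => Es a (fun s => (differ a (s0 a) s)%:R)) <= 2 * eps.
Proof.
have [s0 hs0] : exists s0 : {set V} -> {set V}, forall a, a \in faces X l ->
    Es a (fun s => (differ a (s0 a) s)%:R) <= 2 * E1 a (fun v => pair_differ a (v |: a)).
  apply: (@fin_all_exists _ _ (fun a s => a \in faces X l ->
    Es a (fun s' => (differ a s s')%:R) <= 2 * E1 a (fun v => pair_differ a (v |: a)))) => a.
  case: (boolP (a \in faces X l)) => ha; last by exists set0.
  have he := face_exp ha.
  have [|s [_ _ hs]] := @ex_exists_le _ _ _ _ he predT (fun s1 => Es a (fun s2 => (differ a s1 s2)%:R)).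
    by rewrite (ex1 he).
  exists s => _; rewrite (ex1 he) mulr1 in hs; apply: le_trans hs _.
  (* Values off [a] are masked by [None], so that equality of labels in a finite type is agreement
     on [a]. *)
  pose k s : {ffun V -> option Sigma} := [ffun v => if v \in a then Some (f s v) else None].
  have kE s1 s2 : differ a s1 s2 = (k s1 != k s2).
    apply/differP/idP => [[v va h]|].
      by apply: contra h => /eqP/ffunP/(_ v); rewrite !ffunE va => -[->].
    move=> h; apply/differP; apply: contraNT h => /negPn/forallP h.
    apply/eqP/ffunP => v; rewrite !ffunE; case: ifP => // va.
    by move: (h v); rewrite va => /eqP ->.
  move: (ha); rewrite inE => /andP[aX /eqP al].
  have ad : (#|a| < d)%N by rewrite al.
  apply: le_trans (_ : _ <= Es a (fun s1 => Es a (fun s2 => (k s1 != k s2)%:R))) _.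
    apply: (ex_le he) => s1 _; rewrite mul1r; apply: (ex_le he) => s2 _; by rewrite kE.
  have := label_disagreement hX hw (ltW lam0) Hquad k aX ad; rewrite al => /(_ hhalf) hk.
  apply: le_trans hk _; rewrite ler_pM2l//; apply: (ex_le (Evert ha)) => v /andP[_ vX].
  apply: (ex_le (Es_exp hX hw vX)) => s1 _; apply: (ex_le (Es_exp hX hw vX)) => s2 _.
  by rewrite kE.
exists s0; apply: le_trans (_ : _ <= 2 * EAV (fun a v => pair_differ a (v |: a))) _.
  by rewrite -(exZ Eface); apply: (ex_le Eface).
by rewrite ler_pM2l// base_disagreement.
Qed.

(* If two top faces differ at exactly one vertex of [t], only that vertex contributes to
   the sum over [t]; this gains the factor [l.+1]. *)
Definition surprise a v := Es (v |: a) (fun s1 => Es (v |: a)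
  (fun s2 => (~~ differ a s1 s2 && (f s1 v != f s2 v))%:R)).

Lemma surprise_le : EAV surprise <= eps / l.+1%:R.
Proof.
rewrite ler_pdivlMr ?ltr0n// mulrC.
rewrite -(EE0_sum_in hX hw)//.
apply: (ex_le (EE0_exp hX hw l1)) => t; rewrite inE => /andP[tX _].
have he := Es_exp hX hw tX.
rewrite /pair_differ; under eq_bigr => v vt do rewrite /surprise setD1K//.
rewrite -(ex_sum he); apply: (ex_le he) => s1 _.
rewrite -(ex_sum he); apply: (ex_le he) => s2 _.
case: (boolP (differ t s1 s2)) => [/differP[u ut hu]|hd]; last first.
  rewrite big1// => v vt; case: eqP => [|/eqP h]; rewrite ?andbF//.
  by move: hd; rewrite -(setD1K vt) differU1 h.
rewrite (bigD1 u)//= big1 ?addr0.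
  by rewrite -[leRHS]/(1%:R) ler_nat; case: (_ && _).
move=> v /andP[vt vu].
have -> : differ (t :\ v) s1 s2 by apply/differP; exists u => //; rewrite !inE ut eq_sym vu.
by [].
Qed.

(** * Popular restrictions and their extension to a further vertex *)

Section Popular.
Variable s0 : {set V} -> {set V}.
Hypothesis hs0 : EE set0 l (fun a => Es a (fun s => (differ a (s0 a) s)%:R)) <= 2 * eps.

(* The popular value on [a] is represented by the top face [s0 a] realizing it.  The
   test in [nok] discards those [a] without a dominant value; it must not depend on [v], so
   that [sampler_variance] makes the dependence on [v] cost only [K / l]. *)
Definition miss a c := Es c (fun s => (differ a (s0 a) s)%:R).
Definition nok a s := (4^-1 < miss a a) || differ a (s0 a) s.

Lemma miss_ge0 a c : c \in X -> 0 <= miss a c.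
Proof. by move=> cX; apply: (ex_ge0 (Es_exp hX hw cX)) => s _; exact: ler0n. Qed.

Lemma nok_le : EE set0 l (fun a => Es a (fun s => (nok a s)%:R)) <= 10 * eps.
Proof.
(* Markov at the threshold 1/4 costs 4 and [differ] itself 1; with [hs0] this gives [5 * 2]. *)
apply: le_trans (_ : _ <= EE set0 l (fun a => 5 * miss a a)) _; last first.
  by rewrite (exZ Eface); move: hs0; rewrite -/(miss _ _); lra.
apply: (ex_le Eface) => a ha; have he := face_exp ha.
rewrite /miss -(exZ he) -/(miss a a).
case: (ltP 4^-1 (miss a a)) => h.
  apply: le_trans (_ : _ <= 1) _.
    by apply: (ex_le1 he) => s _; case: nok.
  rewrite (exZ he) -/(miss a a); lra.
apply: (ex_le he) => s _; rewrite /nok ltNge h /=.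
by case: differ; rewrite /= ?mulr1n ?mulr0n; lra.
Qed.

Definition stray (g : {set V} -> V -> Sigma) a v s := ~~ nok a s && (f s v != g a v).

(** If [miss a a] exceeds 1/4, every [s] is discarded. If revealing [v] leaves at least half of the
    measure to the faces agreeing with [s0 a], averaging over them produces one whose value at [v]
    is off by at most twice [surprise]. In the remaining case [drift] holds, a Chebyshev deviation
    from at most 1/4 to above 1/2. *)
Lemma extension_exists : exists g : {set V} -> V -> Sigma,
  EAV (fun a v => Es (v |: a) (fun s => (stray g a v s)%:R)) <= (2 * (1 + 16 * K)) * (eps / l%:R).
Proof.
pose drift a v := ~~ (4^-1 < miss a a) && (2^-1 < miss a (v |: a)).
have [g hg] : exists g : {set V} -> {ffun V -> Sigma}, forall a v, a \in faces X l -> v |: a \in X ->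
    Es (v |: a) (fun s => (~~ nok a s && (f s v != g a v))%:R) <= 2 * surprise a v + (drift a v)%:R.
  suff h a v : exists z : Sigma, a \in faces X l -> v |: a \in X ->
      Es (v |: a) (fun s => (~~ nok a s && (f s v != z))%:R) <= 2 * surprise a v + (drift a v)%:R.
    apply: (@fin_all_exists _ _ (fun a (g : {ffun V -> Sigma}) => forall v, a \in faces X l -> v |: a \in X ->
      Es (v |: a) (fun s => (~~ nok a s && (f s v != g v))%:R) <= 2 * surprise a v + (drift a v)%:R)) => a; have [g hg] := fin_all_exists (h a).
    by exists (finfun g) => v; rewrite ffunE; apply: hg.
  case: (boolP ((a \in faces X l) && (v |: a \in X))) => [/andP[ha vX]|/negP h]; last first.
    by exists (f set0 v) => ha vX; case: h; rewrite ha.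
  have he := Es_exp hX hw vX.
  have sur0 : 0 <= surprise a v.
    by apply: (ex_ge0 he) => s1 _; apply: (ex_ge0 he) => s2 _; apply: ler0n.
  have le1 z : Es (v |: a) (fun s => (~~ nok a s && (f s v != z))%:R) <= 1.
    by apply: (ex_le1 he) => s _; case: (_ && _).
  case: (boolP (4^-1 < miss a a)) => hfine.
    exists (f set0 v) => _ _; apply: le_trans (_ : _ <= 0) _.
      by rewrite -(ex_cst he 0); apply: (ex_le he) => s _; rewrite /nok hfine.
    by apply: addr_ge0; [apply: mulr_ge0|exact: ler0n].
  rewrite /drift hfine /=; case: (ltP 2^-1 (miss a (v |: a))) => hd.
    exists (f set0 v) => _ _; apply: le_trans (le1 _) _.
    by rewrite lerDr mulr_ge0.
  pose P s := ~~ differ a (s0 a) s.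
  have PE : Es (v |: a) (fun s => (P s)%:R) = 1 - miss a (v |: a).
    rewrite -[X in _ = X - _](ex1 he) -(exB he); apply: (ex_eq he) => s _.
    by rewrite /P; case: differ => /=; rewrite ?subrr ?subr0.
  have P2 : 2^-1 <= Es (v |: a) (fun s => (P s)%:R) by rewrite PE; lra.
  have P0 : 0 < Es (v |: a) (fun s => (P s)%:R) by lra.
  have [s1 [_ Ps1 hs1]] := ex_exists_le he
    (fun s1 => Es (v |: a) (fun s2 => (~~ differ a (s0 a) s2 && (f s2 v != f s1 v))%:R)) P0.
  exists (f s1 v) => _ _; rewrite addr0.
  have hsur : Es (v |: a) (fun x => (P x)%:R * Es (v |: a) (fun s2 =>
      (~~ differ a (s0 a) s2 && (f s2 v != f x v))%:R)) <= surprise a v.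
    apply: (ex_le he) => s _; rewrite -(exZ he); apply: (ex_le he) => s2 _.
    rewrite -natrM ler_nat mulnb; case: (boolP (P s)) => //= Ps.
    case: (boolP (differ a (s0 a) s2)) => //= Ps2.
    by rewrite (differ_trans Ps Ps2) eq_sym.
  have := le_trans hs1 hsur; set y := Es _ _ => hy.
  have -> : Es (v |: a) (fun s => (~~ nok a s && (f s v != f s1 v))%:R) = y.
    by apply: (ex_eq he) => s _; rewrite /nok (negbTE hfine).
  have y0 : 0 <= y by apply: (ex_ge0 he) => s _; apply: ler0n.
  nra.
exists g; apply: le_trans (_ : _ <= EAV (fun a v => 2 * surprise a v + (drift a v)%:R)) _.
  by apply: EAV_le => a v ha _ vX; apply: hg.
rewrite EAV_D EAV_Z.
have e0 := eps_ge0.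
have lR : 0 < l%:R :> R by rewrite ltr0n.
have h1 : EAV surprise <= eps / l%:R.
  apply: le_trans surprise_le _; by rewrite ler_wpM2l// lef_pV2 ?posrE ?ltr0n// ler_nat.
(* The 16 is [4 / (1/2)^2], from [chebyshev] at the threshold 1/2; [2 * eps] comes from [hs0]. *)
have h2 : EAV (fun a v => (drift a v)%:R) <= 16 * (K / l%:R) * (2 * eps).
  have K0 : 0 <= K / l%:R by apply: le_trans hK; rewrite addr_ge0 ?invr_ge0 ?ler0n// ltW.
  apply: le_trans (_ : _ <= EE set0 l (fun a => 16 * (K / l%:R) * miss a a)) _; last first.
    by rewrite (exZ Eface) ler_wpM2l// mulr_ge0.
  apply: (ex_le Eface) => a ha; have hv := Evert ha.
  move: (ha); rewrite inE => /andP[aX /eqP al].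
  case: (ltP 4^-1 (miss a a)) => hfine.
    apply: le_trans (_ : _ <= 0) _; last first.
      by apply: mulr_ge0; [apply: mulr_ge0|apply: miss_ge0].
    by rewrite -(ex_cst hv 0); apply: (ex_le hv) => v _; rewrite /drift hfine.
  have ad : (#|a| + 0 < d)%N by rewrite addn0 al.
  have half0 : 0 < 2^-1 :> R by lra.
  have tl : EE a 0 (fun b => Es (b :|: a) (fun s => (differ a (s0 a) s)%:R)) <= 2^-1 / 2 :> R.
    by rewrite /= set0U -/(miss a a); lra.
  have kl : (d.+1 - (#|a| + 0))%:R^-1 + lam <= K / l%:R.
    by rewrite addn0 al; exact: hK0.
  have := chebyshev hX hw (ltW lam0) Hquad (F := fun _ s => differ a (s0 a) s) aX ad half0 tl kl.
  rewrite /= set0U -/(miss a a) => hc; apply: le_trans (_ : _ <= 4 / 2^-1 ^+ 2 * (K / l%:R * miss a a)) _.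
    apply: le_trans hc; apply: (ex_le hv) => v _.
    by rewrite /drift ltNge hfine /= set0U.
  by rewrite le_eqVlt; apply/orP; left; apply/eqP; field; rewrite gt_eqF.
move: h1 h2; set x := eps / l%:R; set y := EAV surprise; set z := EAV _.
have -> : 16 * (K / l%:R) * (2 * eps) = 32 * K * x by rewrite /x; ring.
lra.
Qed.

(** * Consensus of the local extensions at each vertex *)

Variable g : {set V} -> V -> Sigma.
Hypothesis hg : EAV (fun a v => Es (v |: a) (fun s => (stray g a v s)%:R))
  <= (2 * (1 + 16 * K)) * (eps / l%:R).

Definition clash a b s := nok a s || nok b s.
(** Used with [c = a] and with [c = v |: a]; separating [c] from [a] lets [chebyshev] compare the
    two. *)
Definition theta a c := EE c l (fun b => Es (b :|: c) (fun s => (clash a b s)%:R)).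
(** The first threshold is half of the second, as [chebyshev] requires; the second leaves 7/8 of the
    edges at [a] to [vertex_consensus]. *)
Definition steady a v := (theta a a <= 16^-1) && (theta a (v |: a) <= 8^-1).

Lemma K_ge0 : 0 <= K / l%:R.
Proof. by apply: le_trans hK; rewrite addr_ge0 ?invr_ge0 ?ler0n// ltW. Qed.

Lemma added_face a : a \in faces X l -> expectation (added X a l) (EE a l).
Proof. by rewrite inE => /andP[aX /eqP al]; apply: (EE_exp hX hw aX); rewrite al (leq_trans (ltnW l2)). Qed.

Lemma added_faceU1 a v : a \in faces X l -> v |: a \in X ->
  expectation (added X (v |: a) l) (EE (v |: a) l).
Proof.
rewrite inE => /andP[aX /eqP al] vX; apply: (EE_exp hX hw vX).
by rewrite cardsU1 al; have h := ltnW l2; case: (v \notin a); [exact: h|exact: leqW h].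
Qed.

Lemma added_exp c k b : added X c k b ->
  expectation (fun s => (s \in faces X d.+1) && (b :|: c \subset s)) (Es (b :|: c)).
Proof. by move=> /and3P[_ _ bX]; apply: (Es_exp hX hw bX). Qed.

Lemma theta_ge0 a : a \in faces X l -> 0 <= theta a a.
Proof.
move=> ha; apply: (ex_ge0 (added_face ha)) => b hb.
by apply: (ex_ge0 (added_exp hb)) => s _; exact: ler0n.
Qed.

Lemma theta_le : EE set0 l (fun a => theta a a) <= 20 * eps.
Proof.
have lld : (l + l <= d.+1)%N by rewrite leqW// ltnW.
apply: le_trans (_ : _ <= EE set0 l (fun a => EE a l (fun b => Es (b :|: a) (fun s => (nok a s)%:R))
   + EE a l (fun b => Es (b :|: a) (fun s => (nok b s)%:R)))) _.
  apply: (ex_le Eface) => a ha; rewrite -(exD (added_face ha)).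
  apply: (ex_le (added_face ha)) => b hb; rewrite -(exD (added_exp hb)).
  apply: (ex_le (added_exp hb)) => s _; rewrite -natrD ler_nat /clash.
  by case: nok; case: nok.
rewrite (exD Eface).
have tower a : a \in faces X l ->
    EE a l (fun b => Es (b :|: a) (fun s => (nok a s)%:R)) = Es a (fun s => (nok a s)%:R).
  by rewrite inE => /andP[aX /eqP al]; rewrite -(Es_tower hX hw)// al.
have -> : EE set0 l (fun a => EE a l (fun b => Es (b :|: a) (fun s => (nok b s)%:R)))
    = EE set0 l (fun b => EE b l (fun a => Es (a :|: b) (fun s => (nok b s)%:R))).
  rewrite (EE0_swap hX hw)//; apply: (ex_eq Eface) => b hb.
  by apply: (ex_eq (added_face hb)) => a _; rewrite setUC.
have -> : EE set0 l (fun b => EE b l (fun a => Es (a :|: b) (fun s => (nok b s)%:R)))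
    = EE set0 l (fun b => Es b (fun s => (nok b s)%:R)).
  by apply: (ex_eq Eface) => b hb; rewrite tower.
by have := nok_le; lra.
Qed.

(** The part of unsteadiness created by revealing [v]; being a Chebyshev event, it costs order
    [eps / l] instead of [eps]. *)
Definition escapes a v := (theta a a <= 16^-1) && (8^-1 < theta a (v |: a)).

Lemma escapes_le : EAV (fun a v => (escapes a v)%:R) <= 320 * (16 * K) * (eps / l%:R).
Proof.
apply: le_trans (_ : _ <= EE set0 l (fun a => 256 * (K / l%:R) * theta a a)) _; last first.
  rewrite (exZ Eface); have h : 0 <= 256 * (K / l%:R) by rewrite mulr_ge0 ?K_ge0.
  apply: le_trans (ler_wpM2l h theta_le) _.
  by rewrite le_eqVlt; apply/orP; left; apply/eqP; ring.
apply: (ex_le Eface) => a ha; have hv := Evert ha.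
move: (ha); rewrite inE => /andP[aX /eqP al].
case: (lerP (theta a a) 16^-1) => hth; last first.
  apply: le_trans (_ : _ <= 0) _; last first.
    by apply: mulr_ge0; [apply: mulr_ge0 => //; apply: K_ge0|apply: theta_ge0].
  by rewrite -(ex_cst hv 0); apply: (ex_le hv) => v _; rewrite /escapes [theta a a <= _]leNgt hth.
have ad : (#|a| + l < d)%N by rewrite al.
have e0 : 0 < 8^-1 :> R by lra.
have tl : theta a a <= 8^-1 / 2 by lra.
have kl : (d.+1 - (#|a| + l))%:R^-1 + lam <= K / l%:R by rewrite al.
have := chebyshev hX hw (ltW lam0) Hquad (F := clash a) aX ad e0 tl kl.
rewrite /= -/(theta a a) => hc; apply: le_trans (_ : _ <= 4 / 8^-1 ^+ 2 * (K / l%:R * theta a a)) _.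
  by apply: le_trans hc; apply: (ex_le hv) => v _; rewrite /escapes hth.
by rewrite le_eqVlt; apply/orP; left; apply/eqP; field; rewrite gt_eqF ?ltr0n.
Qed.

Lemma wavering_le : EE set0 l (fun a => (16^-1 < theta a a)%R%:R) <= 320 * eps.
Proof.
have h16 : 0 < 16^-1 :> R by lra.
have := ex_markov Eface h16 theta_ge0; rewrite invrK => h.
by apply: le_trans h _; have := theta_le; lra.
Qed.

(** The first term does not improve with [l]; the missing factor is supplied in [consensus_exists]
    by the square of the spectral bound. *)
Lemma unsteady_le :
  EAV (fun a v => (~~ steady a v)%:R) <= 320 * eps + 320 * (16 * K) * (eps / l%:R).
Proof.
apply: le_trans (lerD wavering_le escapes_le); rewrite -EAV_cst -EAV_D.
apply: EAV_le => a v _ _ _; rewrite -natrD ler_nat /steady /escapes !ltNge.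
by case: (theta a a <= _); case: (theta a _ <= _).
Qed.

Lemma added1 v a : added X [set v] l a -> [/\ a \in faces X l, v \notin a & v |: a \in X].
Proof.
move=> /and3P[/eqP al dv]; rewrite setUC => vX; split=> //.
  by rewrite inE al eqxx (face_sub hX vX).
by move: dv; rewrite disjoints_subset => /subsetP h; apply/negP => /h; rewrite !inE eqxx.
Qed.

(* Let [p z] and [q z] be the measures of [{steady a, g a v = z}] and [{g a v = z}].  A steady
   [a] keeps 7/8 of its edges to disjoint [b]; apart from stray ones these stay in the
   class of [z], so [7/8 p z <= stray + p z q z + lam2 sqrt (p z q z)], where
   [q z <= 1/2] for every [z] but the plurality value. *)
Lemma vertex_consensus v : [set v] \in X -> exists z : Sigma,
  EE [set v] l (fun a => (steady a v && (g a v != z))%:R) <=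
  16 * (2 * EE [set v] l (fun a => Es (v |: a) (fun s => (stray g a v s)%:R))
    + ((l * l)%:R * lam) ^+ 2 * EE [set v] l (fun a => (~~ steady a v)%:R)).
Proof.
move=> vX; have vl : (#|[set v]| + l <= d.+1)%N by rewrite cards1.
have vll : (#|[set v]| + l + l <= d.+1)%N by rewrite cards1 -addnA ltnS ltnW.
have hE := EE_exp hX hw vX vl.
have hEa a (ha : added X [set v] l a) :
    expectation (added X (a :|: [set v]) l) (EE (a :|: [set v]) l).
  have [aF va vaX] := added1 ha; rewrite setUC; exact: added_faceU1.
pose q z := EE [set v] l (fun a => (g a v == z)%:R).
have [z zmax] : exists z, forall z', q z' <= q z.
  case: (@arg_maxP _ _ _ (f set0 v) predT q isT) => z _ h.
  by exists z => z'; apply: h.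
exists z.
set lam2 := (l * l)%:R * lam.
have lam20 : 0 < lam2 by rewrite mulr_gt0// ltr0n muln_gt0 l0.
set D := EE [set v] l (fun a => Es _ _); set B := EE [set v] l (fun a => (~~ _)%:R).
set P := EE [set v] l _.
have qhalf z' : z' != z -> q z' <= 2^-1.
  move=> hz; have : q z + q z' <= 1.
    rewrite -(exD hE); apply: (ex_le1 hE) => a _; rewrite -natrD.
    rewrite -[leRHS]/(1%:R) ler_nat; case: eqP => [->|_]; last by case: eqP.
    by rewrite eq_sym (negbTE hz).
  by have := zmax z'; lra.
pose p z' := EE [set v] l (fun a => (steady a v && (g a v == z'))%:R).
have psum : \sum_(z' | z' != z) p z' = P.
  rewrite -(ex_sum hE); apply: (ex_eq hE) => a _.
  case: (boolP (steady a v)) => _ /=; last by rewrite big1.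
  case: (eqVneq (g a v) z) => [e|ne] /=.
    by rewrite big1// => z' hz; rewrite e eq_sym (negbTE hz).
  rewrite (bigD1 (g a v))//= eqxx big1 ?addr0// => z' /andP[_ hz].
  by rewrite eq_sym (negbTE hz).
(* A bound by 1 would not suffice: the error [lam2 ^ 2] has to multiply quantities controlled by
   [eps]. *)
have qsum : \sum_(z' | z' != z) q z' <= P + B.
  rewrite -(ex_sum hE) -(exD hE); apply: (ex_le hE) => a _.
  case: (eqVneq (g a v) z) => [e|ne] /=.
    rewrite big1; first by rewrite addr_ge0 ?ler0n.
    by move=> z' hz; rewrite e eq_sym (negbTE hz).
  rewrite (bigD1 (g a v))//= eqxx big1 ?addr0.
    by case: steady; rewrite /= ?addr0 ?add0r.
  by move=> z' /andP[_ hz]; rewrite eq_sym (negbTE hz).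
pose T z' := EE [set v] l (fun a => (steady a v && (g a v == z'))%:R
   * EE (a :|: [set v]) l (fun b => (g b v == z')%:R)).
have sqb (b : bool) : b%:R ^+ 2 = b%:R :> R by case: b; rewrite ?expr1n ?expr0n.
have Tle z' : z' != z -> T z' <= p z' * (3 / 4) + lam2 ^+ 2 * q z'.
  (* This scale turns the additive bound of [swap_bound] into [p z' / 4 + lam2 ^ 2 * q z']; with
     [q z' <= 1/2] the coefficient of [p z'] becomes [1/2 + 1/4]. *)
  move=> hz; pose y := (2 * lam2)^-1.
  have y0 : 0 < y by rewrite invr_gt0 mulr_gt0.
  have hy : y * lam2 = 2^-1 by rewrite /y; field; rewrite gt_eqF.
  have := swap_bound hX hw (ltW lam0) Hquad (fun a => y * (steady a v && (g a v == z'))%:R)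
    (fun b => (g b v == z')%:R) vX vll.
  have -> : EE [set v] l (fun a => y * (steady a v && (g a v == z'))%:R
     * EE (a :|: [set v]) l (fun b => (g b v == z')%:R)) = y * T z'.
    by rewrite -(exZ hE); apply: (ex_eq hE) => a _; rewrite mulrA.
  rewrite (exZ hE) -/(p z') -/(q z').
  have -> : EE [set v] l (fun a => (y * (steady a v && (g a v == z'))%:R) ^+ 2) = y ^+ 2 * p z'.
    by rewrite -(exZ hE); apply: (ex_eq hE) => a _; rewrite exprMn sqb.
  have -> : EE [set v] l (fun a => (g a v == z')%:R ^+ 2) = q z'.
    by apply: (ex_eq hE) => a _; rewrite sqb.
  rewrite -/lam2 => h.
  have {}h : 2 * (y * T z' - y * p z' * q z') <= lam2 * (y ^+ 2 * p z' + q z').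
    by apply: le_trans h; rewrite ler_pM2l// ler_norm.
  have := ler_wpM2r (ltW lam20) h.
  have -> : 2 * (y * T z' - y * p z' * q z') * lam2
      = 2 * (y * lam2) * (T z' - p z' * q z') by ring.
  have -> : lam2 * (y ^+ 2 * p z' + q z') * lam2
      = (y * lam2) ^+ 2 * p z' + lam2 ^+ 2 * q z' by ring.
  rewrite hy => h1.
  have p0 : 0 <= p z' by apply: (ex_ge0 hE) => a _; exact: ler0n.
  have := ler_wpM2l p0 (qhalf _ hz).
  lra.
pose W Phi := EE [set v] l (fun a => EE (a :|: [set v]) l
   (fun b => Es (b :|: (a :|: [set v])) (Phi a b))).
have Wtower (h : {set V} -> {set V} -> R) : W (fun a _ => h a) = EE [set v] l (fun a => Es (v |: a) (h a)).
  apply: (ex_eq hE) => a ha; have [aF va vaX] := added1 ha.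
  have cva : #|a :|: [set v]| = l.+1.
    by rewrite setUC cardsU1 va; move: aF; rewrite inE => /andP[_ /eqP ->].
  rewrite [v |: a]setUC -(Es_tower hX hw)//; first by rewrite setUC.
  by rewrite cva addSn ltnS ltnW.
have DE : W (fun a _ s => (stray g a v s)%:R) = D by rewrite Wtower.
have DE' : W (fun _ b s => (stray g b v s)%:R) = D.
  rewrite -DE /W (EE_swap hX hw)//; apply: (ex_eq hE) => b hb.
  by apply: (ex_eq (hEa b hb)) => a _; rewrite setUCA.
have le78 : 7 / 8 * P <= W (fun a b s => (steady a v && (g a v != z))%:R * (1 - (clash a b s)%:R)).
  rewrite -(exZ hE); apply: (ex_le hE) => a ha; have hb := hEa a ha.
  have [aF va vaX] := added1 ha.
  case: (boolP (steady a v)) => /= [|_]; last first.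
    rewrite mulr0; apply: (ex_ge0 hb) => b hb'; apply: (ex_ge0 (added_exp hb')) => s _.
    by rewrite mul0r.
  move=> /andP[_ hth].
  have -> : EE (a :|: [set v]) l (fun b => Es (b :|: (a :|: [set v]))
      (fun s => (g a v != z)%:R * (1 - (clash a b s)%:R))) = (g a v != z)%:R * (1 - theta a (v |: a)).
    rewrite /theta [v |: a]setUC -[X in _ = _ * (X - _)](ex1 hb) -(exB hb) -(exZ hb).
    apply: (ex_eq hb) => b hb'; have hs := added_exp hb'.
    by rewrite (exZ hs) (exB hs) (ex1 hs).
  rewrite mulrC ler_wpM2l ?ler0n//; lra.
have : W (fun a b s => (steady a v && (g a v != z))%:R * (1 - (clash a b s)%:R)) <=
    (D + D) + \sum_(z' | z' != z) T z'.
  rewrite -{1}DE -DE' -(exD hE) -(ex_sum hE) -(exD hE).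
  apply: (ex_le hE) => a ha; have hb := hEa a ha.
  have -> : \sum_(z' | z' != z) (steady a v && (g a v == z'))%:R
     * EE (a :|: [set v]) l (fun b => (g b v == z')%:R) =
     EE (a :|: [set v]) l (fun b => \sum_(z' | z' != z) (steady a v && (g a v == z'))%:R * (g b v == z')%:R) :> R.
    by rewrite (ex_sum hb); apply: eq_bigr => z' _; rewrite (exZ hb).
  rewrite -(exD hb) -(exD hb); apply: (ex_le hb) => b hb'; have hs := added_exp hb'.
  rewrite -(exD hs) -[X in _ + X](ex_cst hs) -(exD hs); apply: (ex_le hs) => s _.
  have s0' : 0 <= \sum_(z' | z' != z) (steady a v && (g a v == z'))%:R * (g b v == z')%:R :> R.
    by apply: sumr_ge0 => z' _; rewrite mulr_ge0.
  case: (boolP (steady a v && (g a v != z))) => [/andP[hst hz]|_]; last first.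
    by rewrite mul0r addr_ge0// addr_ge0.
  case: (boolP (clash a b s)) => [_|].
    by rewrite subrr mulr0 addr_ge0// addr_ge0.
  rewrite negb_or /stray => /andP[-> ->] /=; rewrite subr0 mul1r.
  case: (eqVneq (f s v) (g a v)) => [e|ne]; last first.
    by rewrite -addrA lerDl addr_ge0.
  case: (eqVneq (f s v) (g b v)) => [e'|ne']; last first.
    by rewrite add0r lerDl.
  rewrite (bigD1 (g a v))//= hst eqxx -e e' eqxx /= mulr1 !add0r lerDl.
  by apply: sumr_ge0 => z' _; rewrite mulr_ge0.
move=> hW; have := le_trans le78 hW.
have : \sum_(z' | z' != z) T z' <= P * (3 / 4) + lam2 ^+ 2 * (P + B).
  apply: le_trans (_ : _ <= \sum_(z' | z' != z) (p z' * (3 / 4) + lam2 ^+ 2 * q z')) _.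
    by apply: ler_sum => z' hz; apply: Tle.
  rewrite big_split /= -mulr_suml -mulr_sumr psum lerD2l.
  by rewrite ler_wpM2l// sqr_ge0.
(* Since [7/8 - 3/4 - 1/81 > 1/16], the terms in [P] can be collected on one side, which gives the
   factor 16. *)
have hl : lam2 ^+ 2 <= 81^-1.
  have h9 : 0 <= 9^-1 :> R by lra.
  have := ler_pM (ltW lam20) (ltW lam20) hmix hmix; rewrite -expr2 => h.
  by apply: le_trans h _; lra.
have P0 : 0 <= P by apply: (ex_ge0 hE) => a _; exact: ler0n.
have := ler_wpM2r P0 hl.
move: (lam2 ^+ 2) => L2 h1 h2 h3; lra.
Qed.

Lemma consensus_exists : exists G : V -> Sigma,
  EAV (fun a v => (steady a v && (g a v != G v))%:R) <= (16 * 324 * (1 + 16 * K)) * (eps / l%:R).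
Proof.
pose disp v := EE [set v] l (fun a => Es (v |: a) (fun s => (stray g a v s)%:R)).
pose uns v := EE [set v] l (fun a => (~~ steady a v)%:R).
have [G hG] : exists G : {ffun V -> Sigma}, forall v, [set v] \in X ->
    EE [set v] l (fun a => (steady a v && (g a v != G v))%:R) <=
    16 * (2 * disp v + ((l * l)%:R * lam) ^+ 2 * uns v).
  suff h v : exists z : Sigma, [set v] \in X ->
      EE [set v] l (fun a => (steady a v && (g a v != z))%:R) <=
      16 * (2 * disp v + ((l * l)%:R * lam) ^+ 2 * uns v).
    have [G hG] := fin_all_exists h; exists (finfun G) => v; rewrite ffunE; exact: hG.
  case: (boolP ([set v] \in X)) => vX; last by exists (f set0 v).
  by have [z hz] := vertex_consensus vX; exists z.
exists G.
have c0 : (#|@set0 V| <= d)%N by rewrite cards0.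
have hV := E1_exp hX hw (set0X hX hw) c0.
rewrite /EAV -(EE0_swap1 hX hw (fun v a => (steady a v && (g a v != G v))%:R)) //.
apply: le_trans (_ : _ <= E1 set0 (fun v => 32 * disp v + 16 * ((l * l)%:R * lam) ^+ 2 * uns v)) _.
  apply: (ex_le hV) => v /andP[_]; rewrite setU0 => /hG h.
  by apply: le_trans h _; rewrite le_eqVlt; apply/orP; left; apply/eqP; ring.
rewrite (exD hV) !(exZ hV) /disp /uns.
rewrite (EE0_swap1 hX hw (fun v a => Es (v |: a) (fun s => (stray g a v s)%:R))) //.
rewrite (EE0_swap1 hX hw (fun v a => (~~ steady a v)%:R)) //.
rewrite -!/(EAV _).
have e0 := eps_ge0.
have lR : 1 <= l%:R :> R by rewrite -[1]/(1%:R) ler_nat.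
have el : 0 <= eps / l%:R by rewrite divr_ge0.
have K0 : 0 <= K by have := K_ge0; rewrite pmulr_lge0// invr_gt0; lra.
have u0 : 0 <= EAV (fun a v => (~~ steady a v)%:R).
  by apply: (ex_ge0 Eface) => a ha; apply: (ex_ge0 (Evert ha)) => v _; exact: ler0n.
(* Here [hmix2] converts the [eps] of [unsteady_le] into [eps / l]. The final constant is
   [32 * 2 + 16 * 320 = 16 * 324]. *)
have hu : ((l * l)%:R * lam) ^+ 2 * EAV (fun a v => (~~ steady a v)%:R)
   <= (320 + 320 * (16 * K)) * (eps / l%:R).
  apply: le_trans (ler_wpM2r u0 hmix2) _.
  have li : 0 <= l%:R^-1 :> R by rewrite invr_ge0; lra.
  apply: le_trans (ler_wpM2l li unsteady_le) _.
  have h1 : eps / l%:R <= eps by rewrite ler_pdivrMr ?ler_peMr//; lra.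
  have := ler_wpM2l K0 h1 => h2.
  apply: le_trans (_ : _ <= l%:R^-1 * (320 * eps + 320 * (16 * (K * eps)))) _.
    by rewrite ler_wpM2l//; lra.
  by rewrite le_eqVlt; apply/orP; left; apply/eqP; ring.
have : 0 <= K * (eps / l%:R) by rewrite mulr_ge0.
rewrite -(mulrA 16).
move: hg hu; set x := EAV _; set y := _ * EAV _; set e := eps / _ => h1 h2 h3.
lra.
Qed.

(** * From consensus to a global function *)

Section Global.
Variable G : V -> Sigma.
Hypothesis hG : EAV (fun a v => (steady a v && (g a v != G v))%:R)
  <= (16 * 324 * (1 + 16 * K)) * (eps / l%:R).

(** Collects what may be charged to the top face itself and hence must not depend on [v]; the
    failure of [steady] that depends on [v] is left to [wrong_le]. *)
Definition flawed a s := (16^-1 < theta a a) || nok a s.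

Lemma flawed_le : EE set0 l (fun a => Es a (fun s => (flawed a s)%:R)) <= 330 * eps.
Proof.
apply: le_trans (_ : _ <= 320 * eps + 10 * eps) _; last by lra.
apply: le_trans (lerD wavering_le nok_le); rewrite -(exD Eface).
apply: (ex_le Eface) => a ha; have he := face_exp ha.
rewrite -[X in X + _](ex_cst he) -(exD he); apply: (ex_le he) => s _.
by rewrite -natrD ler_nat /flawed; case: (_ < _); case: nok.
Qed.

(** An unflawed error at [v] is a stray value, an escape, or a steady [g a v] different from [G v].
    Each costs order [eps / l], and 345 exceeds [(2 + 320 + 16 * 324) / 16]. *)
Lemma wrong_le : EAV (fun a v => Es (v |: a) (fun s => (~~ flawed a s && (f s v != G v))%:R))
  <= (16 * 345 * (1 + 16 * K)) * (eps / l%:R).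
Proof.
apply: le_trans (_ : _ <= EAV (fun a v => (Es (v |: a) (fun s => (stray g a v s)%:R)
    + (escapes a v)%:R) + (steady a v && (g a v != G v))%:R)) _.
  apply: EAV_le => a v ha va vX; have he := Es_exp hX hw vX.
  rewrite -[X in _ + X + _](ex_cst he) -[X in _ + _ + X](ex_cst he) -!(exD he).
  apply: (ex_le he) => s _; rewrite -!natrD ler_nat /flawed /stray /escapes /steady !ltNge.
  case: (theta a a <= _) => //=; case: (nok a s) => //=; case: (theta a _ <= _) => //=.
    by case: (eqVneq (f s v) (g a v)) => [->|_]; case: (g a v == G v); case: (f s v == G v).
  by case: (f s v == G v); case: (f s v == g a v).
rewrite !EAV_D; have := lerD (lerD hg escapes_le) hG.
have e0 : 0 <= eps / l%:R by rewrite divr_ge0 ?eps_ge0.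
have Ke : 0 <= K * (eps / l%:R).
  by have := mulr_ge0 K_ge0 eps_ge0; rewrite mulrAC mulrA.
move: (eps / l%:R) e0 Ke (EAV _) (EAV _) (EAV _) => e e0 Ke x y z; lra.
Qed.

Definition wrong_part s : R := #|[set v in s | f s v != G v]|%:R / d.+1%:R.

(** Top faces with more than a quarter of flawed subsets have weight at most [4 * 330 * eps]; on the
    others an error fraction above [gam] forces [Q s >= gam / 2]. *)
Lemma soundness_bound (gam : R) : 0 < gam ->
  \sum_(s in faces X d.+1 | gam < wrong_part s) w s
    <= (4 * 330 + 2 * (16 * 345 * (1 + 16 * K)) / (l%:R * gam)) * eps.
Proof.
move=> gam0.
pose C : R := 'C(d.+1, l)%:R.
have C0 : 0 < C by rewrite ltr0n bin_gt0.
pose N : R := (d.+1 - l)%:R.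
have N0 : 0 < N by rewrite ltr0n subn_gt0.
pose beta s : R := C^-1 * \sum_(a : {set V} | (a \subset s) && (#|a| == l)) (flawed a s)%:R.
pose Q s : R := C^-1 * \sum_(a : {set V} | (a \subset s) && (#|a| == l))
  N^-1 * \sum_(v in s :\: a) (~~ flawed a s && (f s v != G v))%:R.
have hb : \sum_(s in faces X d.+1) w s * beta s <= 330 * eps.
  by apply: le_trans flawed_le; rewrite (EE0_Es hX hw) ?lW.
have hQ : \sum_(s in faces X d.+1) w s * Q s <= (16 * 345 * (1 + 16 * K)) * (eps / l%:R).
  apply: le_trans wrong_le; rewrite -(EE0_Es hX hw (fun a s => N^-1 *
     \sum_(v in s :\: a) (~~ flawed a s && (f s v != G v))%:R)) //.
  apply: (ex_le Eface) => a ha; move: (ha); rewrite inE => /andP[aX /eqP al].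
  by rewrite (E1_Es hX hw)// al.
have b0 s : 0 <= beta s.
  by apply: mulr_ge0; rewrite ?invr_ge0 ?(ltW C0)//; apply: sumr_ge0 => a _; apply: ler0n.
(* Removing the vertices of [a] at most doubles the weight of the flawed [a], as
   [d.+1 - l >= d.+1 / 2]. *)
have key s : s \in faces X d.+1 -> wrong_part s * (1 - 2 * beta s) <= Q s.
  move=> hs; have [sX sd] := topP hs.
  pose m : R := #|[set v in s | f s v != G v]|%:R.
  have m0 : 0 <= m by apply: ler0n.
  have step1 : C^-1 * \sum_(a : {set V} | (a \subset s) && (#|a| == l))
      N^-1 * (\sum_(v in s :\: a) (f s v != G v)%:R - (flawed a s)%:R * m) <= Q s.
    rewrite ler_pM2l ?invr_gt0//; apply: ler_sum => a _; rewrite ler_pM2l ?invr_gt0//.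
    case: (boolP (flawed a s)) => _ /=.
      rewrite mul1r [leRHS]big1// subr_le0 /m -sum1_card natr_sum.
      rewrite big_mkcond [leRHS]big_mkcond /=; apply: ler_sum => v _.
      by rewrite !inE; case: (v \in s); case: (v \in a); case: (_ == _).
    by rewrite mul0r subr0.
  apply: le_trans step1.
  have cnt : \sum_(a : {set V} | (a \subset s) && (#|a| == l)) \sum_(v in s :\: a) (f s v != G v)%:R
     = m * 'C(d, l)%:R :> R.
    rewrite (exchange_big_dep (fun v => v \in s)) /=; last by move=> a v _; rewrite inE => /andP[].
    transitivity (\sum_(v in s) (f s v != G v)%:R * 'C(d, l)%:R : R).
      apply: eq_bigr => v vs; rewrite sumr_const -[LHS]mulr_natr; congr (_ * _%:R).
      have <- : #|s :\ v| = d by have := cardsD1 v s; rewrite vs sd add1n => -[].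
      rewrite -cards_draws; apply: eq_card => a; rewrite !inE subsetD1 unfold_in inE vs !andbT.
      by rewrite andbAC.
    rewrite -mulr_suml; congr (_ * _); rewrite /m -sum1_card natr_sum.
    rewrite [LHS]big_mkcond [RHS]big_mkcond; apply: eq_bigr => v _.
    by rewrite inE; case: (v \in s) => //=; case: (_ == _).
  rewrite -mulr_sumr sumrB cnt -mulr_suml.
  have bE : \sum_(a : {set V} | (a \subset s) && (#|a| == l)) (flawed a s)%:R = C * beta s.
    by rewrite /beta mulrA divff ?mul1r// gt_eqF.
  rewrite bE.
  have CN : 'C(d, l)%:R * d.+1%:R = C * N.
    rewrite /C /N -!natrM; congr (_%:R); have h := mul_bin_down d.+1 l.
    by rewrite mulnC h mulnC.
  have d0 : 0 < d.+1%:R :> R by rewrite ltr0n.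
  have -> : wrong_part s = m / d.+1%:R by [].
  have -> : 'C(d, l)%:R = C * N / d.+1%:R by rewrite -CN mulfK// gt_eqF.
  have -> : C^-1 * (N^-1 * (m * (C * N / d.+1%:R) - C * beta s * m)) =
     m * (d.+1%:R^-1 - beta s * N^-1).
    by field; rewrite nat1r !gt_eqF.
  rewrite -mulrA ler_wpM2l// mulrBr mulr1 lerD2l lerN2 mulrCA mulrA [leLHS]mulrC.
  have NI : N^-1 <= 2 / d.+1%:R.
    by rewrite -[N^-1]mul1r ler_pdivrMr// mulrAC ler_pdivlMr// mul1r -natrM ler_nat mulnC double_lt_subS.
  apply: le_trans (ler_wpM2r (b0 s) NI) _.
  by rewrite le_eqVlt; apply/orP; left; apply/eqP; ring.
have Q0 s : 0 <= Q s.
  apply: mulr_ge0; rewrite ?invr_ge0 ?(ltW C0)//; apply: sumr_ge0 => a _.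
  by apply: mulr_ge0; rewrite ?invr_ge0 ?(ltW N0)//; apply: sumr_ge0 => v _; apply: ler0n.
apply: le_trans (_ : _ <= \sum_(s in faces X d.+1) (4 * (w s * beta s) + 2 / gam * (w s * Q s))) _.
  rewrite big_mkcondr /=; apply: ler_sum => s hs.
  have w0 := w_gt0 hw hs.
  have t1 : 0 <= 4 * (w s * beta s) by rewrite mulr_ge0// mulr_ge0// ltW.
  have t2 : 0 <= 2 / gam * (w s * Q s).
    by rewrite mulr_ge0 ?divr_ge0 ?(ltW gam0)// mulr_ge0// ltW.
  case: ifP => hgam; last by rewrite addr_ge0.
  case: (lerP (beta s) 4^-1) => hbeta; last first.
    apply: le_trans (_ : _ <= 4 * (w s * beta s)) _; last by rewrite lerDl.
    have := ltW hbeta => /(ler_wpM2l (ltW w0)); lra.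
  apply: le_trans (_ : _ <= 2 / gam * (w s * Q s)) _; last by rewrite lerDr.
  have : gam / 2 <= Q s.
    apply: le_trans (key s hs).
    have h1 : 2^-1 <= 1 - 2 * beta s by lra.
    have h2 : 0 <= 2^-1 :> R by lra.
    exact: ler_pM (ltW gam0) h2 (ltW hgam) h1.
  move=> h; rewrite mulrCA -[leLHS]mulr1 ler_pM2l//.
  by rewrite -ler_pdivrMl ?divr_gt0// invf_div mulr1.
rewrite big_split /= -!mulr_sumr.
have g0 : 0 <= 2 / gam by rewrite divr_ge0// ltW.
apply: le_trans (lerD (ler_wpM2l _ hb) (ler_wpM2l g0 hQ)) _; first by [].
rewrite le_eqVlt; apply/orP; left; apply/eqP; field.
by rewrite !gt_eqF ?ltr0n.
Qed.

End Global.

End Popular.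
End Agreement.

(** * Rejection probability, numerical constants and conclusion *)

Lemma rejE (R : rcfType) (V Sigma : finType) (X : {set {set V}}) (d l : nat)
    (w : {set V} -> R) (f : {set V} -> V -> Sigma) :
  is_complex X d -> is_weighting X d w -> (l < d)%N ->
  rej X d l w f = eps X d l w f.
Proof.
move=> hX hw ld; rewrite /rej /eps (EE0_prob_face hX hw); last by rewrite ltnS ltnW.
apply: eq_bigr => t; rewrite inE => /andP[tX /eqP tl]; congr (_ * _).
have m0 := mu_gt0 hX hw tX.
have C0 : 0 < 'C(d.+1, #|t|)%:R :> R.
  by rewrite ltr0n bin_gt0 tl ltnS ltnW.
have cond s : prob_cond X d w s t = (if t \subset s then w s else 0) / mu X d w t.
  rewrite /prob_cond prob_faceE /prob_joint; case: ifP => _; last by rewrite !mul0r.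
  by field; rewrite !gt_eqF.
have EsE (h : {set V} -> R) : top_mean X d w t h =
    \sum_(s in faces X d.+1) prob_cond X d w s t * h s.
  rewrite /top_mean mulr_suml big_mkcondr /=; apply: eq_bigr => s _; rewrite cond.
  by case: ifP => _; rewrite ?mul0r// mulrAC.
rewrite /pair_differ EsE; apply: eq_bigr => s1 _; rewrite EsE mulr_sumr.
by apply: eq_bigr => s2 _; rewrite mulrA.
Qed.

(** For [lam = 1 / (d ^ 2 l)] one has [l ^ 2 lam = l / d ^ 2], so the last two bounds are exactly
    [hmix] and [hmix2]. The third is tight at [l = 1], [d = 3]. *)
Lemma link_size_bounds (l d : nat) : (1 <= l)%N -> (l + l < d)%N ->
  [/\ (3 <= d.+1 - l)%N, (9 <= d ^ 2 * l)%N, (9 * l <= d ^ 2)%N & (l ^ 3 <= d ^ 4)%N].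
Proof.
move=> l1 ld; have h : (9 * l <= d ^ 2)%N by rewrite -mulnn; nia.
split=> //; first by lia.
  by apply: leq_trans (leq_pmulr _ l1); apply: leq_trans h; lia.
by apply: (@leq_trans (d ^ 3)); [rewrite leq_exp2r|rewrite leq_pexp2l]; lia.
Qed.

Lemma double_lt_of_gap (R : rcfType) (alpha : R) (l d : nat) :
  0 < alpha -> (l < d)%N -> d%:R / 2 - l%:R >= alpha * d%:R -> (l + l < d)%N.
Proof.
move=> a0 ld hd; have dR : 0 < d%:R :> R by rewrite ltr0n; apply: leq_ltn_trans ld.
have ad : 0 < alpha * d%:R by rewrite mulr_gt0.
by rewrite -(ltr_nat R) natrD; lra.
Qed.

(** The threshold [gam] is left free: approximate soundness takes [r / l], exact soundness a value
    below [1 / d.+1]. *)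
Lemma agreement_soundness (R : rcfType) (V Sigma : finType) (X : {set {set V}}) (d l : nat)
    (w : {set V} -> R) (f : {set V} -> V -> Sigma) (alpha : R) :
  0 < alpha -> (1 <= l)%N -> (l < d)%N -> d%:R / 2 - l%:R >= alpha * d%:R ->
  is_complex X d -> is_weighting X d w ->
  link_expander X d w (1 / ((d ^ 2 * l)%N)%:R) ->
  exists G : V -> Sigma, forall gam : R, 0 < gam ->
    \sum_(s in faces X d.+1 | gam < #|[set v in s | f s v != G v]|%:R / d.+1%:R) w s
    <= (4 * 330 + 2 * (16 * 345 * (1 + 16 * (alpha^-1 + 1))) / (l%:R * gam)) * rej X d l w f.
Proof.
move=> a0 l1 ld hd hX hw hlink.
have lR : 1 <= l%:R :> R by rewrite -[1]/(1%:R) ler_nat.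
have dR : 0 < d%:R :> R by rewrite ltr0n; apply: leq_ltn_trans ld.
have ad : 0 < alpha * d%:R by rewrite mulr_gt0.
have ll := double_lt_of_gap a0 ld hd.
have [b1 b2 b3 b4] := link_size_bounds l1 ll.
set n := (d ^ 2 * l)%N in hlink b2.
have nR : 9 <= n%:R :> R by rewrite -[9]/(9%:R) ler_nat.
set lam : R := 1 / n%:R in hlink.
have lamE : lam = n%:R^-1 by rewrite /lam mul1r.
have lam0 : 0 < lam by rewrite lamE invr_gt0; lra.
have lam9 : lam <= 9^-1 by rewrite lamE lef_pV2 ?posrE//; lra.
have lam1 : lam < 1 by apply: le_lt_trans lam9 _; lra.
have Hquad c (h : V -> R) : c \in X -> (#|c| < d)%N ->
  `|vertex_mean X d w c (fun v => h v * vertex_mean X d w (v |: c) h) - vertex_mean X d w c h ^+ 2|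
    <= lam * vertex_mean X d w c (fun v => h v ^+ 2).
  move=> cX cd; apply: (link_quadratic hX hw _ cX cd (ltW lam0) lam1).
  by apply: hlink => //; case: (d) cd.
have hlam : l%:R * lam = (d ^ 2)%:R^-1.
  by rewrite lamE /n natrM invfM mulrCA divff ?mulr1// gt_eqF//; lra.
have hlam' : (l * l)%:R * lam = l%:R / (d ^ 2)%:R by rewrite natrM -mulrA hlam.
have d2 : 0 < (d ^ 2)%:R :> R by rewrite natrX exprn_gt0.
have hmix : (l * l)%:R * lam <= 9^-1.
  rewrite hlam' ler_pdivrMr// mulrC ler_pdivlMr// mulrC -[9]/(9%:R) -natrM ler_nat //.
have hmix2 : ((l * l)%:R * lam) ^+ 2 <= l%:R^-1.
  rewrite hlam' expr_div_n ler_pdivrMr ?exprn_gt0// mulrC ler_pdivlMr; last by lra.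
  by rewrite -!natrX -natrM -expnM ler_nat -expnSr.
have hhalf : (d.+1 - l)%:R^-1 + lam <= 2^-1.
  have : (d.+1 - l)%:R^-1 <= 3^-1 :> R.
    by rewrite lef_pV2 ?posrE ?ltr0n//; [rewrite -[3]/(3%:R) ler_nat|apply: leq_trans b1].
  lra.
(* The gap gives [d - 2 l >= 2 alpha d], so the first term is at most [alpha^-1 / l]; the summand 1
   absorbs [l lam = 1 / d ^ 2]. *)
have hK : (d.+1 - (l + l))%:R^-1 + lam <= (alpha^-1 + 1) / l%:R.
  rewrite ler_pdivlMr; last by lra.
  rewrite mulrDl [lam * _]mulrC hlam; apply: lerD; last first.
    by rewrite invf_le1// natrX exprn_ege1// -[1]/(1%:R) ler_nat; apply: leq_trans ld.
  have e : (d.+1 - (l + l))%:R = d%:R + 1 - (l%:R + l%:R) :> R.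
    by rewrite natrB ?natrD ?natr1// leqW// ltnW.
  have p : 0 < (d.+1 - (l + l))%:R :> R by rewrite ltr0n subn_gt0 ltnS ltnW.
  rewrite mulrC ler_pdivrMr// mulrC ler_pdivlMr// e; nra.
have [s0 hs0] := popular_exists hX hw lam0 Hquad ll hhalf f.
have [g hg] := extension_exists hX hw lam0 Hquad l1 ll hK hs0.
have [G hG] := consensus_exists hX hw lam0 Hquad l1 ll hK hmix hmix2 hs0 hg.
exists G => gam gam0; rewrite rejE//.
exact: (soundness_bound hX hw lam0 Hquad l1 ll hK hs0 hg hG gam0).
Qed.

Theorem theorem4p1 (R : rcfType) (alpha : R) (halpha : 0 < alpha) :
  (exists c : R, 0 < c /\
    forall (V Sigma : finType) (X : {set {set V}}) (w : {set V} -> R) (d l : nat),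
      (1 <= l)%N -> (l < d)%N ->
      d%:R / 2 - l%:R >= alpha * d%:R ->
      is_complex X d -> is_weighting X d w ->
      link_expander X d w (1 / ((d ^ 2 * l)%N)%:R) ->
      forall r : R, 0 < r ->
        approx_sound Sigma X d l w (r / l%:R) (c * (1 + 1 / r)))
  /\
  (forall beta : R, 0 < beta -> exists c' : R,
    forall (V Sigma : finType) (X : {set {set V}}) (w : {set V} -> R) (d l : nat),
      (1 <= l)%N -> (l < d)%N ->
      d%:R / 2 - l%:R >= alpha * d%:R ->
      l%:R >= beta * d%:R ->
      is_complex X d -> is_weighting X d w ->
      link_expander X d w (1 / ((d ^ 2 * l)%N)%:R) ->
      exact_sound Sigma X d l w c').
Proof.
pose J : R := 16 * 345 * (1 + 16 * (alpha^-1 + 1)).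
have ai : 0 < alpha^-1 by rewrite invr_gt0.
have J0 : 0 < J by rewrite /J !mulr_gt0//; lra.
have rej0 (V Sigma : finType) (X : {set {set V}}) w d l (f : {set V} -> V -> Sigma) :
    is_complex X d -> is_weighting X d w -> (l < d)%N ->
    d%:R / 2 - l%:R >= alpha * d%:R -> 0 <= rej X d l w f :> R.
  move=> hX hw ld hd; rewrite rejE//.
  by apply: (eps_ge0 hX hw); apply: (double_lt_of_gap halpha).
split.
  exists (4 * 330 + 2 * J); split; first by lra.
  move=> V Sigma X w d l l1 ld hd hX hw hlink r r0 f.
  have [G hG] := agreement_soundness f halpha l1 ld hd hX hw hlink.
  have lR : 0 < l%:R :> R by rewrite ltr0n.
  exists G; apply: le_trans (hG (r / l%:R) _) _; first by rewrite divr_gt0.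
  apply: ler_wpM2r; first exact: rej0.
  have -> : l%:R * (r / l%:R) = r by rewrite mulrCA divff ?mulr1// gt_eqF.
  rewrite -/J.
  have : 0 < r^-1 by rewrite invr_gt0.
  rewrite mul1r; move: (r^-1) => x x0; nra.
(* At the threshold used below, [1 / (l gam)] is [2 (d + 1) / l], at most [4 / beta] because
   [d + 1 <= 2 d] and [l >= beta d]. *)
move=> beta beta0; exists (4 * 330 + 2 * J * (4 / beta)).
move=> V Sigma X w d l l1 ld hd hb hX hw hlink f.
have [G hG] := agreement_soundness f halpha l1 ld hd hX hw hlink.
have lR : 0 < l%:R :> R by rewrite ltr0n.
have d0 : 0 < d.+1%:R :> R by rewrite ltr0n.
(* A single wrong vertex is already a fraction [1 / d.+1] of [s], above this threshold. *)
have g0 : 0 < (2 * d.+1%:R)^-1 :> R by rewrite invr_gt0 mulr_gt0.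
exists G; apply: le_trans (_ : _ <= \sum_(s in faces X d.+1 | (2 * d.+1%:R)^-1 < (
    #|[set v in s | f s v != G v]|%:R / d.+1%:R : R)) w s) _.
  rewrite big_mkcondr [leRHS]big_mkcondr /=; apply: ler_sum => s hs.
  have w0 := w_gt0 hw hs.
  case: (boolP [exists v in s, _]) => [/existsP[v /andP[vs hv]]|_]; last first.
    by case: ifP => // _; apply: ltW.
  case: ifP => // /negP[]; rewrite invfM ltr_pM2r ?invr_gt0//.
  apply: lt_le_trans (_ : 1 <= _); first by lra.
  rewrite -[1]/(1%:R) ler_nat card_gt0; apply/set0Pn; exists v.
  by rewrite inE vs.
apply: le_trans (hG _ g0) _; apply: ler_wpM2r; first exact: rej0.
have J2 : 0 < 2 * J by rewrite mulr_gt0.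
have b4 : 0 < beta / 4 by rewrite divr_gt0.
have lg : 0 < l%:R * (2 * d.+1%:R)^-1 :> R by rewrite mulr_gt0.
rewrite -/J lerD2l ler_pM2l// -[4 / beta]invf_div lef_pV2 ?posrE//.
rewrite ler_pdivlMr ?mulr_gt0//.
have d1 : 1 <= d%:R :> R by rewrite -[1]/(1%:R) ler_nat (leq_trans _ ld).
have := ler_wpM2l (ltW beta0) d1.
by rewrite -[d.+1%:R]natr1; lra.
Qed.
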